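(* Let $V$ be a vertex operator algebra with a normalized scalar product $(\cdot|\cdot)$, and assume that $V_0=\mathbb{C}\Omega$. Then the following are equivalent: (i) $(V,(\cdot|\cdot))$ is a unitary vertex operator algebra; (ii) $(V,(\cdot|\cdot))$ has unitary Möbius symmetry and $V^{(\cdot|\cdot)}=V$, i.e. every vertex operator $Y(a,z)$, $a\in V$, has a local adjoint.
   Context: Vertex algebras are over $\mathbb{C}$ and local (not super). A vertex operator algebra (VOA) $V$ has vacuum vector $\Omega$, vertex operators $Y(a,z)=\sum_{n\in\mathbb{Z}}a_{(n)}z^{-n-1}$, and a conformal vector $\nu$ with $Y(\nu,z)=\sum_{n}L_nz^{-n-2}$, where the $L_n$ satisfy the Virasoro relations, $L_{-1}$ is the infinitesimal translation operator, $L_0$ is diagonalizable, $V=\bigoplus_{n\in\mathbb{Z}}V_n$ with $V_n=\mathrm{Ker}(L_0-n1_V)$, $\dim V_n<\infty$, and $V_n=\{0\}$ for $n$ sufficiently small. A bilinear form on $V$ is invariant if $(Y(a,z)b,c)=(b,Y(e^{zL_1}(-z^{-2})^{L_0}a,z^{-1})c)$ for all $a,b,c\in V$. A scalar product is a positive-definite sesquilinear form (linear in the second variable); it is normalized if $(\Omega|\Omega)=1$. It is invariant if there is a VOA antilinear automorphism $\theta$ of $V$ (an antilinear bijection with $\theta(a_{(n)}b)=\theta(a)_{(n)}\theta(b)$ and $\theta(\nu)=\nu$) such that $(\theta\,\cdot\,|\,\cdot)$ is an invariant bilinear form on $V$. A unitary VOA is a pair $(V,(\cdot|\cdot))$ with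 $(\cdot|\cdot)$ a normalized invariant scalar product. $(V,(\cdot|\cdot))$ has unitary Möbius symmetry if $(L_na|b)=(a|L_{-n}b)$ for all $a,b\in V$ and $n=-1,0,1$. In that case every $a_{(n)}$ has an adjoint $a_{(n)}^+\in\mathrm{End}(V)$, i.e. $(b|a_{(n)}c)=(a_{(n)}^+b|c)$ for all $b,c\in V$, and $Y(a,z)^+:=\sum_{n\in\mathbb{Z}}a_{(n)}^+z^{n+1}$ is a field on $V$. The vertex operator $Y(a,z)$ has a local adjoint if for every $b\in V$ there is $N\in\mathbb{Z}_{\ge0}$ with $(z-w)^N[Y(a,z)^+,Y(b,w)]=0$. $V^{(\cdot|\cdot)}$ denotes the set of $a\in V$ such that $Y(a,z)$ has a local adjoint. *)

(* Defs.v *)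
From HB Require Import structures.
From mathcomp Require Import all_boot all_order all_algebra.
From mathcomp Require Import all_classical reals.
From mathcomp.real_closed Require Import complex.

Set Implicit Arguments.
Unset Strict Implicit.
Unset Printing Implicit Defensive.

Import Order.TTheory GRing.Theory Num.Theory.

Local Open Scope classical_set_scope.
Local Open Scope complex_scope.
Local Open Scope ring_scope.

(** A formal distribution A(z) = \sum_n A_(n) z^(-n-1) on V is encoded by its
    modes A : int -> V -> V. *)

(** (z - w)^N [A(z), B(w)] = 0: the left-hand side below is the coefficient of
    z^(-m-1) w^(-n-1), applied to v. *)
Definition commute_at_order (K : numClosedFieldType) (V : lmodType K)
    (A B : int -> V -> V) (N : nat) : Prop :=
  forall (m n : int) (v : V),
    \sum_(j < N.+1) ((-1) ^+ j * 'C(N, j)%:R : K) *: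
      (A (m + (N - j)%N%:Z) (B (n + j%:Z) v)
       - B (n + j%:Z) (A (m + (N - j)%N%:Z) v)) = 0.

Definition mutually_local (K : numClosedFieldType) (V : lmodType K)
    (A B : int -> V -> V) : Prop :=
  exists N : nat, commute_at_order A B N.

(** [Y a n b] is a_(n) b. *)
Record vertexAlgebra (R : realType) : Type := VertexAlgebra {
  va_sort :> lmodType R[i];
  vacuum : va_sort;
  transl : va_sort -> va_sort;
  Y : va_sort -> int -> va_sort -> va_sort;
  transl_linear : linear transl;
  Y_linearl : forall (n : int) (b : va_sort), linear (fun a => Y a n b);
  Y_linearr : forall (a : va_sort) (n : int), linear (Y a n);
  Y_field : forall a b : va_sort,
    exists N : int, forall n : int, N <= n -> Y a n b = 0;
  (* [T, Y(a,z)] = d/dz Y(a,z) *)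
  Y_transl : forall (a : va_sort) (n : int) (b : va_sort),
    transl (Y a n b) - Y a n (transl b) = - (Y a (n - 1) b *~ n);
  transl_vacuum : transl vacuum = 0;
  (* Y(Omega,z) = 1_V *)
  Y_vacuum : forall (n : int) (b : va_sort),
    Y vacuum n b = if n == -1 then b else 0;
  (* Y(a,z)Omega is a power series in z with constant term a *)
  Y_creation : forall (a : va_sort) (n : int), 0 <= n -> Y a n vacuum = 0;
  Y_creation1 : forall a : va_sort, Y a (-1) vacuum = a;
  Y_local : forall a b : va_sort, mutually_local (Y a) (Y b)
}.

(** Y(nu,z) = \sum_n L_n z^(-n-2), i.e. L_n = nu_(n+1). *)
Definition virasoro_mode (R : realType) (V : vertexAlgebra R) (nu : V)
  (n : int) : V -> V := Y nu (n + 1).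

Definition eigen_L0 (R : realType) (V : vertexAlgebra R) (nu : V)
  (n : int) : set V := [set v | virasoro_mode nu 0 v = v *~ n].

Definition weight_decomposition (R : realType) (V : vertexAlgebra R) (nu : V)
    (v : V) (f : int -> V) : Prop :=
  [/\ finite_set [set d | f d != 0],
      forall d : int, eigen_L0 nu d (f d)
    & v = \sum_(d \in [set: int]) f d].

Record VOA (R : realType) : Type := MkVOA {
  voa_va :> vertexAlgebra R;
  conformal : voa_va;
  voa_virasoro : exists c : R[i], forall (m n : int) (v : voa_va),
    virasoro_mode conformal m (virasoro_mode conformal n v)
    - virasoro_mode conformal n (virasoro_mode conformal m v)
    = virasoro_mode conformal (m + n) v *~ (m - n)
      + (if m + n == 0 then c / 12%:R * (m ^+ 3 - m)%:~R else 0) *: v;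
  voa_transl : forall v : voa_va,
    virasoro_mode conformal (-1) v = transl v;
  (* directness of V = \bigoplus_n V_n is automatic: eigenspaces are
     independent *)
  voa_grading : forall v : voa_va,
    exists f : int -> voa_va, weight_decomposition conformal v f;
  voa_findim : forall n : int, exists (k : nat) (e : 'I_k -> voa_va),
    (forall i, eigen_L0 conformal n (e i)) /\
    forall v, eigen_L0 conformal n v ->
      exists x : 'I_k -> R[i], v = \sum_(i < k) x i *: e i;
  voa_bounded : exists N : int, forall n : int, n < N ->
    eigen_L0 conformal n = [set 0]
}.

Section VOATheory.
Variables (R : realType) (V : VOA R).

Definition L : int -> V -> V := virasoro_mode (conformal V).

Definition wt (n : int) : set V := eigen_L0 (conformal V) n.

(** The component of v in V_d. *)
Definition wt_comp (d : int) (v : V) : V := sval (cid (voa_grading v)) d.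

(** The coefficient of z^k in e^(z L_1) (-z^(-2))^(L_0) a: the component of a
    in V_d contributes \sum_l (-1)^d z^(l-2d) / l! L_1^l. The family has finite
    support, because V_n = 0 for small n. *)
Definition exp_L1_L0_coef (a : V) (k : int) : V :=
  \sum_(p \in [set p : nat * int | p.1%:Z - 2 * p.2 = k])
    ((-1) ^ p.2 / (p.1)`!%:R : R[i]) *: iter p.1 (L 1) (wt_comp p.2 a).

(** The coefficient of z^(-n-1) in Y(e^(z L_1) (-z^(-2))^(L_0) a, z^(-1)) c;
    the mode m of Y(_, z^(-1)) comes with z^(m+1). *)
Definition opposite_mode (a : V) (n : int) (c : V) : V :=
  \sum_(k \in [set: int]) Y (exp_L1_L0_coef a k) (- n - 2 - k) c.

Definition bilinear_form (B : V -> V -> R[i]) : Prop :=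
  (forall (x : R[i]) (a b c : V), B (x *: a + b) c = x * B a c + B b c) /\
  (forall (x : R[i]) (a b c : V), B a (x *: b + c) = x * B a b + B a c).

Definition invariant_bilinear_form (B : V -> V -> R[i]) : Prop :=
  bilinear_form B /\
  forall (a b c : V) (n : int), B (Y a n b) c = B b (opposite_mode a n c).

(** Hermitian symmetry follows, by polarization. *)
Definition scalar_product (h : V -> V -> R[i]) : Prop :=
  [/\ forall (x : R[i]) (a b c : V), h (x *: a + b) c = x^* * h a c + h b c,
      forall (x : R[i]) (a b c : V), h a (x *: b + c) = x * h a b + h a c
    & forall a : V, a != 0 -> 0 < h a a].

Definition normalized (h : V -> V -> R[i]) : Prop :=
  h (vacuum V) (vacuum V) = 1.

Definition antilinear_automorphism (theta : V -> V) : Prop :=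
  [/\ forall (x : R[i]) (a b : V),
        theta (x *: a + b) = x^* *: theta a + theta b,
      bijective theta,
      forall (a b : V) (n : int),
        theta (Y a n b) = Y (theta a) n (theta b)
    & theta (conformal V) = conformal V].

Definition invariant_scalar_product (h : V -> V -> R[i]) : Prop :=
  scalar_product h /\
  exists theta : V -> V, antilinear_automorphism theta /\
    invariant_bilinear_form (fun a b => h (theta a) b).

Definition unitary_VOA (h : V -> V -> R[i]) : Prop :=
  normalized h /\ invariant_scalar_product h.

Definition unitary_moebius_symmetry (h : V -> V -> R[i]) : Prop :=
  forall n : int, n \in [:: -1; 0; 1] ->
    forall a b : V, h (L n a) b = h a (L (- n) b).

Definition adjoint_of (h : V -> V -> R[i]) (S T : V -> V) : Prop :=
  linear S /\ forall b c : V, h b (T c) = h (S b) c.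

(** The adjoint modes [ad n] = a_(n)^+ are unique when h is a scalar product.
    Since Y(a,z)^+ = \sum_n a_(n)^+ z^(n+1), its mode of index m, the
    coefficient of z^(-m-1), is a_(-m-2)^+. *)
Definition has_local_adjoint (h : V -> V -> R[i]) (a : V) : Prop :=
  exists ad : int -> V -> V,
    (forall n : int, adjoint_of h (ad n) (Y a n)) /\
    forall b : V, mutually_local (fun m => ad (- m - 2)) (Y b).

Definition local_adjoint_set (h : V -> V -> R[i]) : set V :=
  [set a | has_local_adjoint h a].

End VOATheory.

Arguments L {R} V n v.
Arguments wt {R} V n v.

(* Main.v *)
(** Write a°(n) for the modes of the opposite field
    Y°(a,z) = Y(e^(z L_1) (-z^(-2))^(L_0) a, z^(-1)), and (.|.) for h.

    If (.|.) is invariant with reflection theta, then (theta a)_(n) is the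
    adjoint of a°(n); so the adjoint of a_(n) is an opposite mode of
    theta^(-1) a, a finite combination of modes, which gives local adjoints,
    and the Moebius symmetry is the case a = nu.

    Conversely, [L_1, Y°(a,z)] = - d/dz Y°(a,z), so the adjoints of the a°(n)
    form a translation covariant field, local with all Y(b,w). By Goddard's
    uniqueness theorem it is a vertex operator Y(theta a, z), which defines
    theta. The point is that theta is multiplicative, that is,
    B(a, b) = (theta a | b) is invariant. On the three-point function
    t(a,b,c) = (theta b | Y(a,1) c), skew-symmetry of Y gives the effect of
    exchanging a and c, and skew-symmetry for theta a and theta b that of
    exchanging a and b; composing them one finds the effect of exchanging b
    and c, which is the invariance of B. No module structure on the dual is
    needed. Finally u = theta nu - nu satisfies u_(1) = 0, while skew-symmetry
    gives u_(1) nu = 2 u, because L_1 u = 0 and L_2 u lies in V_0 = C Omega. *)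
Require Import Defs.
From HB Require Import structures.
From mathcomp Require Import all_boot all_order all_algebra.
From mathcomp Require Import all_classical reals.
From mathcomp.real_closed Require Import complex.
From mathcomp Require Import ring zify.

Set Implicit Arguments.
Unset Strict Implicit.
Unset Printing Implicit Defensive.

Import Order.TTheory GRing.Theory Num.Theory.

Local Open Scope classical_set_scope.
Local Open Scope complex_scope.
Local Open Scope ring_scope.

(** * Module identities *)

Section SquareZero.
Variables (K : comNzRingType) (W : lmodType K).

(** The trivial extension $K \oplus W$ with $W^2 = 0$: scalars and vectors live in one commutative
    ring, so linear identities become polynomial ones. *)
Definition sqzero : Type := (K * W)%type.
HB.instance Definition _ := GRing.Zmodule.on sqzero.
Definition sqzero_mul (x y : sqzero) : sqzero :=
  (x.1 * y.1, x.1 *: y.2 + y.1 *: x.2).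
Definition sqzero_one : sqzero := (1, 0).

Lemma sqzero_mulA : associative sqzero_mul.
Proof.
move=> [x u] [y v] [z w]; congr (_, _) => /=; first by rewrite mulrA.
by rewrite !scalerDr !scalerA addrA [z * x]mulrC [z * y]mulrC.
Qed.
Lemma sqzero_mulC : commutative sqzero_mul.
Proof. by move=> [x u] [y v]; congr (_, _) => /=; rewrite 1?mulrC 1?addrC. Qed.
Lemma sqzero_mul1 : left_id sqzero_one sqzero_mul.
Proof.
by move=> [x u]; congr (_, _) => /=; rewrite ?mul1r // scale1r scaler0 addr0.
Qed.
Lemma sqzero_mulDl : left_distributive sqzero_mul +%R.
Proof.
move=> [x u] [y v] [z w]; congr (_, _) => /=; first by rewrite mulrDl.
by rewrite scalerDl scalerDr addrACA.
Qed.
Lemma sqzero_neq0 : sqzero_one != 0.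
Proof. by apply/eqP => -[] /eqP; rewrite oner_eq0. Qed.
HB.instance Definition _ := GRing.Zmodule_isComNzRing.Build sqzero
  sqzero_mulA sqzero_mulC sqzero_mul1 sqzero_mulDl sqzero_neq0.

Definition sqz_scalar (x : K) : sqzero := (x, 0).
Definition sqz_vector (w : W) : sqzero := (0, w).

Lemma sqz_scalar_zmod : zmod_morphism sqz_scalar.
Proof. by move=> x y; congr (_, _) => /=; rewrite subr0. Qed.
HB.instance Definition _ :=
  GRing.isZmodMorphism.Build K sqzero sqz_scalar sqz_scalar_zmod.
Lemma sqz_scalar_monoid : monoid_morphism sqz_scalar.
Proof. by split=> // x y; congr (_, _) => /=; rewrite !scaler0 addr0. Qed.
HB.instance Definition _ :=
  GRing.isMonoidMorphism.Build K sqzero sqz_scalar sqz_scalar_monoid.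
Lemma sqz_vector_zmod : zmod_morphism sqz_vector.
Proof. by move=> x y; congr (_, _) => /=; rewrite subr0. Qed.
HB.instance Definition _ :=
  GRing.isZmodMorphism.Build W sqzero sqz_vector sqz_vector_zmod.

Lemma sqz_vectorD u v : sqz_vector (u + v) = sqz_vector u + sqz_vector v.
Proof. exact: raddfD. Qed.
Lemma sqz_vectorN u : sqz_vector (- u) = - sqz_vector u.
Proof. exact: raddfN. Qed.
Lemma sqz_vector0 : sqz_vector 0 = 0.
Proof. exact: raddf0. Qed.
Lemma sqz_vectorMn u n : sqz_vector (u *+ n) = sqz_vector u *+ n.
Proof. exact: raddfMn. Qed.
Lemma sqz_vectorMz u n : sqz_vector (u *~ n) = sqz_vector u * n%:~R.
Proof. by rewrite raddfMz mulrzr. Qed.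
Lemma sqz_vectorZ x w : sqz_vector (x *: w) = sqz_scalar x * sqz_vector w.
Proof. by congr (_, _) => /=; rewrite ?mulr0 // scaler0 addr0. Qed.
Definition sqz_vectorE :=
  (sqz_vectorD, sqz_vectorN, sqz_vector0, sqz_vectorMn, sqz_vectorMz,
   sqz_vectorZ).
Lemma sqz_vector_inj : injective sqz_vector.
Proof. by move=> u v []. Qed.
End SquareZero.

(* An identity in a module is checked by [ring] in the square-zero extension. *)
Ltac module := apply: (@sqz_vector_inj _ _); rewrite ?sqz_vectorE; ring.

(** * Locality *)

Section DifferenceOperator.
Variables (K : comNzRingType) (W : lmodType K).
Implicit Types g : int -> int -> W.

(* Multiplication by z - w on the coefficients of z^(-m-1) w^(-n-1). *)
Definition mulzw g : int -> int -> W := fun m n => g (m + 1) n - g m (n + 1).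

Lemma iter_mulzw0 N : iter N mulzw (fun _ _ => 0) = (fun _ _ => 0).
Proof.
elim: N => //= N ->; apply/funext => m; apply/funext => n.
by rewrite /mulzw subr0.
Qed.

Lemma iter_mulzwD N g g' :
  iter N mulzw (fun m n => g m n + g' m n) =
  (fun m n => iter N mulzw g m n + iter N mulzw g' m n).
Proof.
elim: N => //= N ->; apply/funext => m; apply/funext => n.
by rewrite /mulzw addrACA opprD.
Qed.

(** Binomial expansion of $(z-w)^N$, by Pascal's rule; up to scalars it is the sum in
    [commute_at_order]. *)
Lemma iter_mulzwE N g m n :
  iter N mulzw g m n =
  \sum_(j < N.+1)
    (g (m + (N - j)%N%:Z) (n + j%:Z) *~ ((-1) ^+ j * 'C(N, j)%:Z)).
Proof.
elim: N m n => [|N IH] m n.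
  by rewrite big_ord_recl big_ord0 /= expr0 bin0 mul1r !addr0.
rewrite iterS /mulzw !IH big_ord_recl [RHS]big_ord_recl /=.
rewrite [in X in _ - X]big_ord_recr [in RHS]big_ord_recr /=.
rewrite -/(iter _ _ _).
rewrite !subnn !bin0 !binn !expr0 !mul1r !subn0 !addr0.
rewrite opprD !addrA -!addrA; congr (_ + _).
rewrite addrA; congr (_ + _).
  rewrite -sumrB; apply: eq_bigr => j _.
  rewrite /bump /= !add1n subSS binS.
  have hj := ltn_ord j.
  have -> : m + 1 + (N - j.+1)%N%:Z = m + (N - j)%N%:Z by lia.
  have -> : n + 1 + j%:Z = n + j.+1%:Z by lia.
  rewrite -mulrzBr; congr (_ *~ _).
  by rewrite PoszD exprS; ring.
rewrite /bump /= !add1n -mulrNz.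
by congr (g _ _ *~ _); rewrite ?exprS; lia.
Qed.

Lemma iter_mulzwB N g g' :
  iter N mulzw (fun m n => g m n - g' m n) =
  (fun m n => iter N mulzw g m n - iter N mulzw g' m n).
Proof.
elim: N => //= N ->; apply/funext => m; apply/funext => n.
rewrite /mulzw; module.
Qed.

(* d/dz and d/dw on the coefficients of z^(-m-1) w^(-n-1). *)
Definition derz g : int -> int -> W := fun m n => - (g (m - 1) n *~ m).
Definition derw g : int -> int -> W := fun m n => - (g m (n - 1) *~ n).

(** Leibniz rule: $(z-w)\,\partial_z g = \partial_z((z-w)g) - g$. *)
Lemma mulzw_derz g :
  mulzw (derz g) = (fun m n => derz (mulzw g) m n + - g m n).
Proof.
apply/funext => m; apply/funext => n; rewrite /mulzw /derz.
rewrite addrK subrK; module.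
Qed.

(** Differentiation costs one more factor $z-w$, by induction from the Leibniz rule. *)
Lemma iter_mulzw_derz N g :
  iter N mulzw g = (fun _ _ => 0) -> iter N.+1 mulzw (derz g) = (fun _ _ => 0).
Proof.
elim: N g => [|N IH] g.
  move=> /= ->; apply/funext => m; apply/funext => n.
  by rewrite /mulzw /derz !mul0rz !oppr0 addr0.
move=> g0; rewrite iterSr mulzw_derz iter_mulzwD IH -?iterSr //.
have -> : (fun m n => - g m n) = (fun m n => 0 - g m n).
  by apply/funext => m; apply/funext => n; rewrite sub0r.
apply/funext => m; apply/funext => n; rewrite add0r iter_mulzwE.
have := iter_mulzwE N.+1 g m n; rewrite g0 => e0.
under eq_bigr do rewrite sub0r mulNrz.
by rewrite sumrN -e0 oppr0.
Qed.

(** $\partial_z + \partial_w$ kills $z-w$, hence commutes with multiplication by it. *)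
Lemma mulzw_der g :
  mulzw (fun m n => derz g m n + derw g m n) =
  (fun m n => derz (mulzw g) m n + derw (mulzw g) m n).
Proof.
apply/funext => m; apply/funext => n; rewrite /mulzw /derz /derw.
rewrite /= ?addrK ?subrK; module.
Qed.

Lemma iter_mulzw_der N g :
  iter N mulzw (fun m n => derz g m n + derw g m n) =
  (fun m n => derz (iter N mulzw g) m n + derw (iter N mulzw g) m n).
Proof. by elim: N => //= N ->; rewrite mulzw_der. Qed.

(** Expansion of $z^N = ((z-w)+w)^N$, where a power of $z$ or $w$ acts by shifting an index. *)
Lemma iter_mulzw_shift N g m n :
  g (m + N%:Z) n =
  \sum_(j < N.+1) iter j mulzw g m (n + (N - j)%N%:Z) *+ 'C(N, j).
Proof.
elim: N m n => [|N IH] m n.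
  by rewrite big_ord_recl big_ord0 /= !addr0.
have -> : m + N.+1%:Z = m + 1 + N%:Z by lia.
rewrite IH.
have E j x : iter j mulzw g (m + 1) x =
    iter j.+1 mulzw g m x + iter j mulzw g m (x + 1).
  by rewrite /= /mulzw subrK.
under eq_bigr do rewrite E mulrnDl.
rewrite big_split /= [in X in X + _]big_ord_recr [in X in _ + X]big_ord_recl /=.
rewrite [RHS]big_ord_recl [in RHS]big_ord_recr /=.
rewrite !subn0 !bin0 !binn !subnn /bump /= ?add0n ?add1n ?subnn.
have -> : n + N%:Z + 1 = n + N.+1%:Z by lia.
rewrite [LHS]addrCA; congr (_ + _).
rewrite addrAC; congr (_ + _).
rewrite -big_split /=; apply: eq_bigr => j _.
rewrite add1n binS mulrnDr addrC subSS; congr (_ *+ _ + _).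
by congr (mulzw _ _ _); have := ltn_ord j; lia.
Qed.

End DifferenceOperator.

Arguments mulzw {K W} g m n.
Arguments derz {K W} g m n.
Arguments derw {K W} g m n.

Lemma iter_mulzw_linear (K : comNzRingType) (W W' : lmodType K)
    (f : {linear W -> W'}) N g :
  iter N mulzw (fun m n => f (g m n)) = (fun m n => f (iter N mulzw g m n)).
Proof.
elim: N => //= N ->; apply/funext => m; apply/funext => n.
by rewrite /mulzw linearB.
Qed.

Lemma iter_comm T (f g : T -> T) (p : nat) x :
  (forall y, f (g y) = g (f y)) -> iter p f (g x) = g (iter p f x).
Proof. by move=> fg; elim: p => //= p ->. Qed.

(** * Differences of three variables, for Dong's lemma *)

Section ThreeVariables.
Variables (K : comNzRingType) (W : lmodType K).
Implicit Types U : int -> int -> int -> W.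

(** [mul12], [mul13], [mul23] multiply by $z_1-z_2$, $z_1-z_3$, $z_2-z_3$ on the coefficients of
    $z_1^{-m-1}z_2^{-n-1}z_3^{-k-1}$. *)
Definition mul12 U : int -> int -> int -> W :=
  fun m n k => U (m + 1) n k - U m (n + 1) k.
Definition mul13 U : int -> int -> int -> W :=
  fun m n k => U (m + 1) n k - U m n (k + 1).
Definition mul23 U : int -> int -> int -> W :=
  fun m n k => U m (n + 1) k - U m n (k + 1).

Let zero : int -> int -> int -> W := fun _ _ _ => 0.

Lemma iter_mul23_zero p : iter p mul23 zero = zero.
Proof.
elim: p => //= p ->; apply/funext=> m; apply/funext=> n; apply/funext=> k.
by rewrite /mul23 subr0.
Qed.

Lemma iter_mul23B p U U' :
  iter p mul23 (fun m n k => U m n k - U' m n k) =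
  (fun m n k => iter p mul23 U m n k - iter p mul23 U' m n k).
Proof.
elim: p => //= p ->; apply/funext=> m; apply/funext=> n; apply/funext=> k.
rewrite /mul23; module.
Qed.

Lemma mul12_13 U : mul12 (mul13 U) = mul13 (mul12 U).
Proof.
apply/funext=> m; apply/funext=> n; apply/funext=> k.
rewrite /mul12 /mul13; module.
Qed.

Lemma mul12_23 U : mul12 (mul23 U) = mul23 (mul12 U).
Proof.
apply/funext=> m; apply/funext=> n; apply/funext=> k.
rewrite /mul12 /mul23; module.
Qed.

Lemma mul13_23 U : mul13 (mul23 U) = mul23 (mul13 U).
Proof.
apply/funext=> m; apply/funext=> n; apply/funext=> k.
rewrite /mul13 /mul23; module.
Qed.

Lemma iter_mul13B p U U' :
  iter p mul13 (fun m n k => U m n k - U' m n k) =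
  (fun m n k => iter p mul13 U m n k - iter p mul13 U' m n k).
Proof.
elim: p => //= p ->; apply/funext=> m; apply/funext=> n; apply/funext=> k.
rewrite /mul13; module.
Qed.

Lemma mul23E U :
  mul23 U = (fun m n k => mul13 U m n k - mul12 U m n k).
Proof.
apply/funext=> m; apply/funext=> n; apply/funext=> k.
rewrite /mul12 /mul23 /mul13; module.
Qed.

(* (z2 - z3) = (z1 - z3) - (z1 - z2), hence the binomial argument. *)
Lemma mul23_vanish p q r U :
  iter p mul12 U = zero -> iter r mul23 (iter q mul13 U) = zero ->
  iter (r + p + q) mul23 U = zero.
Proof.
have [s] := ubnP (p + q); elim: s p q U => // s IH [|p] [|q] U le_s U12 U13.
- by move: U12 => /= ->; rewrite iter_mul23_zero.
- by move: U12 => /= ->; rewrite iter_mul23_zero.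
- by rewrite addn0 addnC iterD (U13 : iter r _ U = _) iter_mul23_zero.
(* Split one factor $z_2-z_3$: the part $z_1-z_3$ uses up one power counted by [q], the part
   $z_1-z_2$ one counted by [p], and the induction applies to both. *)
rewrite addnS iterSr mul23E iter_mul23B.
have -> : iter (r + p.+1 + q) mul23 (mul13 U) = zero.
  apply: IH; first by rewrite addnS in le_s.
    rewrite iter_comm; last exact: mul12_13.
    by rewrite U12; apply/funext=> m; apply/funext=> n; apply/funext=> k;
      rewrite /mul13 subr0.
  by rewrite -iterSr.
have -> : iter (r + p.+1 + q) mul23 (mul12 U) = zero.
  have -> : (r + p.+1 + q = r + p + q.+1)%N by lia.
  apply: IH.
  - by rewrite addSn in le_s.
  - by rewrite -iterSr.
  - rewrite (@iter_comm _ mul13 mul12) => [|y]; last by rewrite mul12_13.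
    rewrite (@iter_comm _ mul23 mul12) => [|y]; last by rewrite mul12_23.
    rewrite U13; apply/funext=> m; apply/funext=> n; apply/funext=> k.
    by rewrite /mul12 subr0.
by apply/funext=> m; apply/funext=> n; apply/funext=> k; rewrite subr0.
Qed.

Lemma iter_mul12E N U k :
  (fun m n => iter N mul12 U m n k) = iter N mulzw (fun m n => U m n k).
Proof.
elim: N => //= N IH; apply/funext => m; apply/funext => n.
by rewrite -IH.
Qed.

Lemma iter_mul13E N U n :
  (fun m k => iter N mul13 U m n k) = iter N mulzw (fun m k => U m n k).
Proof.
elim: N => //= N IH; apply/funext => m; apply/funext => k.
by rewrite -IH.
Qed.

Lemma iter_mul23E N U m :
  (fun n k => iter N mul23 U m n k) = iter N mulzw (fun n k => U m n k).
Proof.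
elim: N => //= N IH; apply/funext => n; apply/funext => k.
by rewrite -IH.
Qed.

End ThreeVariables.

Arguments mul12 {K W} U m n k.
Arguments mul13 {K W} U m n k.
Arguments mul23 {K W} U m n k.

Section Locality.
Variables (K : numClosedFieldType) (V : lmodType K).
Implicit Types A B D : int -> V -> V.

Definition comm_modes A B (v : V) : int -> int -> V :=
  fun m n => A m (B n v) - B n (A m v).

Lemma commute_at_orderP A B N :
  commute_at_order A B N <->
  forall v, iter N mulzw (comm_modes A B v) = (fun _ _ => 0).
Proof.
have E m n v : \sum_(j < N.+1) ((-1) ^+ j * 'C(N, j)%:R : K) *:
      (A (m + (N - j)%N%:Z) (B (n + j%:Z) v)
       - B (n + j%:Z) (A (m + (N - j)%N%:Z) v)) =
    iter N mulzw (comm_modes A B v) m n.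
  rewrite iter_mulzwE; apply: eq_bigr => j _.
  rewrite -scaler_int; congr (_ *: _).
  by rewrite rmorphM rmorphXn /= rmorphN1.
split=> [c v|c m n v]; last by rewrite E c.
by apply/funext => m; apply/funext => n; rewrite -E c.
Qed.

Lemma commute_at_order_leq A B N N' :
  (N <= N')%N -> commute_at_order A B N -> commute_at_order A B N'.
Proof.
move=> leN /commute_at_orderP c; apply/commute_at_orderP => v.
by rewrite -(subnK leN) iterD c iter_mulzw0.
Qed.

Lemma mutually_local_leq A B :
  mutually_local A B ->
  exists N0, forall N, (N0 <= N)%N -> commute_at_order A B N.
Proof. by move=> [N c]; exists N => N' le; apply: commute_at_order_leq c. Qed.

Lemma mutually_local_eq A A' B :
  (forall n v, A n v = A' n v) -> mutually_local A B -> mutually_local A' B.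
Proof.
move=> e; suff -> : A' = A by [].
by apply/funext => n; apply/funext => v.
Qed.

Lemma mutually_local_shift A B k :
  mutually_local A B -> mutually_local (fun n => A (n + k)) B.
Proof.
move=> [N c]; exists N => m n v; rewrite -[RHS](c (m + k) n v).
by apply: eq_bigr => j _; rewrite addrAC.
Qed.

Lemma mutually_local_lin A A' B (x : K) : (forall n, linear (B n)) ->
  mutually_local A B -> mutually_local A' B ->
  mutually_local (fun n v => x *: A n v + A' n v) B.
Proof.
move=> linB /mutually_local_leq[N cN] /mutually_local_leq[N' cN'].
have {}cN := cN (N + N')%N (leq_addr _ _).
have {}cN' := cN' (N + N')%N (leq_addl _ _).
exists (N + N')%N => m n v.
transitivity (x *: 0 + 0 : V); last by rewrite scaler0 addr0.
rewrite -[X in _ = _ *: X + _](cN m n v) -[X in _ = _ + X](cN' m n v).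
rewrite scaler_sumr -big_split /=; apply: eq_bigr => j _.
rewrite linB; module.
Qed.

Lemma mutually_local_zero B : (forall n, linear (B n)) ->
  mutually_local (fun _ _ => 0) B.
Proof.
move=> linB; exists 0%N => m n v; rewrite big1 // => j _.
have := linB (n + j%:Z) (-1) 0 0; rewrite scaler0 addr0 => ->.
by rewrite scaleN1r addNr subr0 scaler0.
Qed.

Lemma mutually_local_sum (I : Type) (r : seq I) (x : I -> K)
    (A : I -> int -> V -> V) B : (forall n, linear (B n)) ->
  (forall i, mutually_local (A i) B) ->
  mutually_local (fun n v => \sum_(i <- r) x i *: A i n v) B.
Proof.
move=> linB locA; elim: r => [|i r IH].
  apply: mutually_local_eq (mutually_local_zero linB) => n v.
  by rewrite big_nil.
apply: mutually_local_eq (mutually_local_lin (x i) linB (locA i) IH) => n v.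
by rewrite big_cons.
Qed.

Lemma mutually_local_derivative A B : (forall n, linear (B n)) ->
  mutually_local A B -> mutually_local (fun n v => - (A (n - 1) v *~ n)) B.
Proof.
move=> linB [N /commute_at_orderP c]; exists N.+1; apply/commute_at_orderP => v.
rewrite -[RHS](iter_mulzw_derz (c v)); congr (iter _ _ _).
apply/funext => m; apply/funext => n; rewrite /comm_modes /derz.
have BD u w : B n (u + w) = B n u + B n w by rewrite -[u]scale1r linB !scale1r.
have B0 : B n 0 = 0 by apply: (@addrI _ (B n 0)); rewrite -BD !addr0.
have BZ y u : B n (y *: u) = y *: B n u by rewrite -[y *: u]addr0 linB B0 addr0.
rewrite -[A _ v *~ _]scaler_int -scaleNr BZ; module.
Qed.

End Locality.

(** * Vertex algebras *)

Section VertexAlgebra.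
Variables (R : realType) (V : vertexAlgebra R).
Local Notation K := R[i].
Local Notation T := (@transl R V).
Local Notation Om := (vacuum V).
Implicit Types a b c v : V.

HB.instance Definition _ a n :=
  GRing.isLinear.Build K V V *:%R (Y a n) (Y_linearr a n).
HB.instance Definition _ :=
  GRing.isLinear.Build K V V *:%R T (@transl_linear R V).

(** Puts the vector [a] last, so that linearity in it can be registered as a structure. *)
Definition Yl n b a := Y a n b.
HB.instance Definition _ n b :=
  GRing.isLinear.Build K V V *:%R (Yl n b) (Y_linearl n b).

Lemma YDl a a' n b : Y (a + a') n b = Y a n b + Y a' n b.
Proof. exact: (linearD (Yl n b)). Qed.
Lemma YZl x a n b : Y (x *: a) n b = x *: Y a n b.
Proof. exact: (linearZ_LR (Yl n b)). Qed.
Lemma Y0l n b : Y 0 n b = 0 :> V.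
Proof. exact: (linear0 (Yl n b)). Qed.
Lemma YBl a a' n b : Y (a - a') n b = Y a n b - Y a' n b.
Proof. exact: (linearB (Yl n b)). Qed.
Lemma YMzl a n b k : Y (a *~ k) n b = Y a n b *~ k.
Proof. by rewrite -[a *~ k]scaler_int YZl scaler_int. Qed.
Lemma Ysuml (I : Type) (r : seq I) (P : pred I) (F : I -> V) n b :
  Y (\sum_(i <- r | P i) F i) n b = \sum_(i <- r | P i) Y (F i) n b.
Proof. exact: (linear_sum (Yl n b)). Qed.

Lemma YD a n b b' : Y a n (b + b') = Y a n b + Y a n b'.
Proof. exact: linearD. Qed.
Lemma YZ x a n b : Y a n (x *: b) = x *: Y a n b.
Proof. exact: linearZ_LR. Qed.
Lemma Y0 a n : Y a n 0 = 0.
Proof. exact: linear0. Qed.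
Lemma YB a n b b' : Y a n (b - b') = Y a n b - Y a n b'.
Proof. exact: linearB. Qed.
Lemma YMz a n b k : Y a n (b *~ k) = Y a n b *~ k.
Proof. by rewrite -[b *~ k]scaler_int YZ scaler_int. Qed.

Lemma translMz b k : T (b *~ k) = T b *~ k.
Proof. by rewrite -[b *~ k]scaler_int linearZ_LR /= scaler_int. Qed.

Lemma translD u v : T (u + v) = T u + T v.
Proof. exact: linearD. Qed.
Lemma translN u : T (- u) = - T u.
Proof. exact: linearN. Qed.
Lemma translB u v : T (u - v) = T u - T v.
Proof. exact: linearB. Qed.
Lemma translZ x u : T (x *: u) = x *: T u.
Proof. exact: linearZ_LR. Qed.
Lemma transl0 : T 0 = 0.
Proof. exact: linear0. Qed.

Lemma Y_translD a n b : T (Y a n b) = Y a n (T b) - Y a (n - 1) b *~ n.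
Proof. by rewrite -(Y_transl a n b) addrC subrK. Qed.

Lemma transl_Y_vacuum a n : T (Y a n Om) = - (Y a (n - 1) Om *~ n).
Proof. by rewrite Y_translD transl_vacuum Y0 sub0r. Qed.

(** Core of Goddard's uniqueness theorem: $(z-w)^N D(z)Y(b,w)\Omega = (z-w)^N Y(b,w)D(z)\Omega = 0$,
    and the coefficient of $w^0$ on the left is $z^N D(z)b$. *)
Lemma local_annihilating_vacuum (D : int -> V -> V) b :
  mutually_local D (Y b) -> (forall n, D n 0 = 0) ->
  (forall n, D n Om = 0) -> forall n, D n b = 0.
Proof.
move=> [N c] D0 DOm n.
have := c (n - N%:Z) (-1) Om; rewrite big_ord_recl big1 => [|j _].
  rewrite expr0 bin0 mulr1 scale1r addr0 subn0 subrK !addr0.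
  by rewrite Y_creation1 DOm Y0 subr0.
by rewrite /= /bump /= DOm Y0 subr0 Y_creation ?D0 ?scaler0 //; lia.
Qed.

(** The series satisfies $T D(z) = D'(z)$; with no negative powers and no constant term it vanishes
    recursively, since $k D_{-k-1} = T D_{-k}$. *)
Lemma transl_covariant_vacuum (D : int -> V) :
  (forall n, T (D n) = - (D (n - 1) *~ n)) ->
  (forall n, -1 <= n -> D n = 0) -> forall n, D n = 0.
Proof.
move=> TD D0 n; have [le|gt] := leP (-1) n; first exact: D0.
have -> : n = - (absz n)%:Z by lia.
elim: (absz n) => [|k IH]; first by rewrite oppr0 D0.
have [-> |k0] := eqVneq k 0%N; first exact: D0.
have := TD (- k%:Z); rewrite IH transl0 => /esym/eqP.
rewrite oppr_eq0 -scaler_int scaler_eq0 intr_eq0 oppr_eq0 /=.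
rewrite eqz_nat (negPf k0) /= => /eqP e.
by rewrite -[RHS]e; congr D; lia.
Qed.

(** Descending from the truncation bound, $T f_{m+1} = -(m+1) f_m$ determines $f_m$ as long as $m+1
    \neq 0$; this yields a power series. *)
Lemma transl_covariant_nonneg (f : int -> V) :
  (forall n, T (f n) = - (f (n - 1) *~ n)) ->
  (exists M, forall n, M <= n -> f n = 0) -> forall n, 0 <= n -> f n = 0.
Proof.
move=> Tf [M fM] n n0.
suff H (k : nat) m : 0 <= m -> M - k%:Z <= m -> f m = 0.
  by apply: (H (absz (M - n)%R)) => //; lia.
elim: k m => [|k IH] m m0 le; first by apply: fM; lia.
have := Tf (m + 1); rewrite IH; [|lia|lia].
rewrite transl0 addrK => /esym/eqP.
rewrite oppr_eq0 -scaler_int scaler_eq0 intr_eq0 => /orP[/eqP|/eqP//]; lia.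
Qed.

(** Uniqueness applied to $Y(Ta,z) - \partial_z Y(a,z)$, which is local with all vertex operators
    and kills $\Omega$. *)
Lemma Y_transl_mode a n b : Y (T a) n b = - (Y a (n - 1) b *~ n).
Proof.
apply/eqP; rewrite -subr_eq0; apply/eqP.
pose D n v := Y (T a) n v - (- (Y a (n - 1) v *~ n)).
rewrite -/(D n b); apply: local_annihilating_vacuum n.
- apply: mutually_local_eq (mutually_local_lin (-1) (Y_linearr b)
    (mutually_local_derivative (Y_linearr b) (Y_local a b))
    (Y_local (T a) b)) => n v.
  by rewrite /D; module.
- by move=> n; rewrite /D !Y0 mul0rz oppr0 subr0.
apply: transl_covariant_vacuum => n.
  rewrite /D translB translN translMz !transl_Y_vacuum; module.
rewrite /D; have [-> _|n1] := eqVneq n (-1); last first.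
  move=> n0; rewrite Y_creation; last by lia.
  have [->|n2] := eqVneq n 0; first by rewrite mulr0z oppr0 subr0.
  by rewrite Y_creation ?mul0rz ?oppr0 ?addr0 //; lia.
rewrite Y_creation1 -[a in T a](Y_creation1 a) transl_Y_vacuum; module.
Qed.

(* c_j(z) = Res_x (x - z)^j [a(x), b(z)]. *)
Definition residue_product a b j n v :=
  iter j mulzw (comm_modes (Y a) (Y b) v) 0 n.

Lemma residue_product_linear a b j n : linear (residue_product a b j n).
Proof.
move=> x u v; rewrite /residue_product !iter_mulzwE scaler_sumr -big_split.
apply: eq_bigr => i _; rewrite /comm_modes /= !linearP /=; module.
Qed.

(** Expand $x^m = ((x-z)+z)^m$ before taking the residue in $x$. *)
Lemma comm_residue_product a b (m : nat) n v :
  Y a m%:Z (Y b n v) - Y b n (Y a m%:Z v) =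
  \sum_(j < m.+1) residue_product a b j (n + (m - j)%N%:Z) v *+ 'C(m, j).
Proof.
by have := iter_mulzw_shift m (comm_modes (Y a) (Y b) v) 0 n; rewrite add0r.
Qed.

End VertexAlgebra.

(** * Dong's lemma and the commutator formula for nonnegative modes *)

Section Borcherds.
Variables (R : realType) (V : vertexAlgebra R).
Local Notation K := R[i].
Local Notation T := (@transl R V).
Local Notation Om := (vacuum V).
Implicit Types a b c v : V.

(* Dong's lemma *)
Lemma residue_product_local a b c j :
  mutually_local (residue_product a b j) (Y c).
Proof.
have [p /commute_at_orderP cab] := Y_local a b.
have [q /commute_at_orderP cac] := Y_local a c.
have [r /commute_at_orderP cbc] := Y_local b c.
exists (r + p + q)%N; apply/commute_at_orderP => v.
(* Coefficients of $[[Y(a,z_1),Y(b,z_2)],Y(c,z_3)]v$. *)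
pose U m n k := comm_modes (Y a) (Y b) (Y c k v) m n
                - Y c k (comm_modes (Y a) (Y b) v m n).
pose zero : int -> int -> int -> V := fun _ _ _ => 0.
have U12 : iter p mul12 U = zero.
  apply/funext => m; apply/funext => n; apply/funext => k.
  rewrite -[LHS]/((fun m n => iter p mul12 U m n k) m n) iter_mul12E.
  by rewrite /U iter_mulzwB iter_mulzw_linear !cab linear0 subr0.
have U13 : iter r mul23 (iter q mul13 U) = zero.
  (* Jacobi identity $[[a,b],c] = [a,[b,c]] - [b,[a,c]]$: the first term dies under $(z_2-z_3)^r$,
     the second under $(z_1-z_3)^q$. *)
  pose U1 m n k := Y a m (comm_modes (Y b) (Y c) v n k)
                   - comm_modes (Y b) (Y c) (Y a m v) n k.
  pose U2 m n k := Y b n (comm_modes (Y a) (Y c) v m k)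
                   - comm_modes (Y a) (Y c) (Y b n v) m k.
  have -> : U = fun m n k => U1 m n k - U2 m n k.
    apply/funext => m; apply/funext => n; apply/funext => k.
    rewrite /U /U1 /U2 /comm_modes !linearB /=; module.
  rewrite iter_mul13B.
  have U2_0 : iter q mul13 U2 = zero.
    apply/funext => m; apply/funext => n; apply/funext => k.
    rewrite -[LHS]/((fun m k => iter q mul13 U2 m n k) m k) iter_mul13E.
    by rewrite /U2 iter_mulzwB iter_mulzw_linear !cac linear0 subr0.
  have U1_0 : iter r mul23 U1 = zero.
    apply/funext => m; apply/funext => n; apply/funext => k.
    rewrite -[LHS]/((fun n k => iter r mul23 U1 m n k) n k) iter_mul23E.
    by rewrite /U1 iter_mulzwB iter_mulzw_linear !cbc linear0 subr0.
  rewrite U2_0 /zero.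
  have -> : (fun m n k => iter q mul13 U1 m n k - 0) = iter q mul13 U1.
    by apply/funext => m; apply/funext => n; apply/funext => k; rewrite subr0.
  elim: q {cac U2_0} => [|q IH]; first exact: U1_0.
  rewrite iterS (@iter_comm _ mul23 mul13) => [|y]; last by rewrite mul13_23.
  rewrite IH; apply/funext => m; apply/funext => n; apply/funext => k.
  by rewrite /mul13 subr0.
have U23 := mul23_vanish U12 U13.
(* Taking the residue in $z_1$ means fixing the first index at 0, which does not interfere with
   $z_2-z_3$. *)
have -> : comm_modes (residue_product a b j) (Y c) v =
    fun n k => iter j mul12 U 0 n k.
  apply/funext => n; apply/funext => k.
  rewrite -[RHS]/((fun m n => iter j mul12 U m n k) 0 n) iter_mul12E.
  by rewrite /U iter_mulzwB iter_mulzw_linear.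
apply/funext => n; apply/funext => k.
rewrite -(iter_mul23E _ _ 0).
have -> : iter (r + p + q) mul23 (iter j mul12 U) = zero; last by [].
elim: j => [|j IH]; first exact: U23.
rewrite iterS (@iter_comm _ mul23 mul12) => [|y]; last by rewrite mul12_23.
rewrite IH; apply/funext => m; apply/funext => n'; apply/funext => k'.
by rewrite /mul12 subr0.
Qed.

(** Uniqueness again: Dong's lemma makes the difference of the two fields local, and on $\Omega$ it
    is translation covariant with zero constant term. *)
Lemma Y_residue_product a b (j : nat) n v :
  Y (Y a j%:Z b) n v = residue_product a b j n v.
Proof.
apply/eqP; rewrite -subr_eq0; apply/eqP.
pose D n v := Y (Y a j%:Z b) n v - residue_product a b j n v.
rewrite -/(D n v); apply: local_annihilating_vacuum n.
- apply: mutually_local_eq (mutually_local_lin (-1) (Y_linearr v)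
    (@residue_product_local a b v j) (Y_local (Y a j%:Z b) v)) => n w.
  by rewrite /D; module.
- move=> n; rewrite /D Y0 sub0r; apply/eqP; rewrite oppr_eq0; apply/eqP.
  have := residue_product_linear a b j n (-1) 0 0.
  by rewrite scaler0 addr0 scaleN1r addNr.
apply: transl_covariant_vacuum => n.
  rewrite /D translB transl_Y_vacuum /residue_product.
  pose g := comm_modes (Y a) (Y b) Om.
  have Tg : (fun m n => T (g m n)) = fun m n => derz g m n + derw g m n.
    apply/funext => m; apply/funext => k.
    rewrite /g /comm_modes translB !Y_translD transl_vacuum.
    rewrite /derz /derw /comm_modes !(YB, Y0, YMz); module.
  have := iter_mulzw_linear T j g; rewrite Tg iter_mulzw_der.
  move=> /(congr1 (fun f => f 0 n)) /= <-.
  (* A residue kills a derivative: at index 0 the term [derz] carries the factor 0. *)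
  by rewrite /derz /derw mulr0z oppr0 add0r; module.
rewrite /D /residue_product iter_mulzwE.
have [-> _|n1 n2] := eqVneq n (-1).
  rewrite Y_creation1 big_ord_recl big1 ?addr0 => [|i _]; last first.
    rewrite /comm_modes /= Y_creation /bump //=.
    by rewrite [X in Y b _ X]Y_creation // !Y0 subr0 mul0rz.
  rewrite /comm_modes expr0 bin0 mul1r mulr1z add0r subn0 Y_creation1.
  by rewrite [X in _ - (_ - Y b _ X)]Y_creation // Y0 subr0 subrr.
rewrite Y_creation; last by lia.
rewrite big1 ?subr0 // => i _; rewrite /comm_modes.
rewrite [X in Y a _ X]Y_creation; last by lia.
by rewrite [X in Y b _ X]Y_creation ?Y0 ?subr0 ?mul0rz //; lia.
Qed.

Theorem commutator_formula a b (m : nat) n v :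
  Y a m%:Z (Y b n v) - Y b n (Y a m%:Z v) =
  \sum_(j < m.+1) Y (Y a j%:Z b) (n + (m - j)%N%:Z) v *+ 'C(m, j).
Proof.
rewrite comm_residue_product; apply: eq_bigr => j _.
by rewrite Y_residue_product.
Qed.
End Borcherds.

Lemma signz_parity (F : fieldType) (m n k : int) :
  m = n + 2 * k -> (-1) ^ m = (-1) ^ n :> F.
Proof.
move=> ->; rewrite exprzDr ?unitrN1 // -exprz_exp.
have -> : (-1) ^ (2 : int) = 1 :> F by rewrite -exprnP sqrrN expr1n.
by rewrite exp1rz mulr1.
Qed.

(** * Skew-symmetry $Y(a,z)b = e^{zT}Y(b,-z)a$, mode by mode *)

Section SkewSymmetry.
Variables (R : realType) (V : vertexAlgebra R).
Local Notation K := R[i].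
Local Notation T := (@transl R V).
Local Notation Om := (vacuum V).
Implicit Types a b c v : V.

Lemma iter_translD j u v : iter j T (u + v) = iter j T u + iter j T v.
Proof. by elim: j => //= j ->; rewrite translD. Qed.

Lemma iter_translZ j x v : iter j T (x *: v) = x *: iter j T v.
Proof. by elim: j => //= j ->; rewrite translZ. Qed.

Lemma iter_transl0 j : iter j T 0 = 0.
Proof. by elim: j => //= j ->; rewrite transl0. Qed.

(* If N is the locality order of a and b, then
   H(z, w) = (z - w)^N Y(a,z)Y(b,w)Om = (z - w)^N Y(b,w)Y(a,z)Om is a power
   series with T H = (d/dz + d/dw) H, so that H(z, 0) = e^(zT) H(0, -z). *)
Theorem skew_symmetry a b : exists M : int, forall n (J : nat), M <= n + J%:Z ->
  Y a n b =
  \sum_(j < J) ((-1) ^ (n + j%:Z + 1) / j`!%:R) *: iter j T (Y b (n + j%:Z) a).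
Proof.
have [N /commute_at_orderP c] := Y_local a b.
pose g m n := Y a m (Y b n Om); pose g' m n := Y b n (Y a m Om).
have gg' : iter N mulzw g = iter N mulzw g'.
  apply/funext => m; apply/funext => n; apply/eqP; rewrite -subr_eq0.
  by rewrite -[X in X == _]/((fun m n => _ - _) m n) -iter_mulzwB c.
have Hg m : iter N mulzw g m (-1) = Y a (m + N%:Z) b.
  rewrite iter_mulzwE big_ord_recl big1 => [|j _].
    by rewrite /g expr0 bin0 mul1r mulr1z !addr0 subn0 Y_creation1.
  by rewrite /g Y_creation /bump //= Y0 mul0rz.
have Hg' n : iter N mulzw g' (-1) n = (-1) ^+ N *: Y b (n + N%:Z) a.
  rewrite iter_mulzwE big_ord_recr big1 => [|j _] /=.
    rewrite /g' binn mulr1 subnn addr0 Y_creation1 add0r -scaler_int.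
    by rewrite rmorphXn /= rmorphN1.
  rewrite /g' [X in Y b _ X]Y_creation ?Y0 ?mul0rz //.
  by have := ltn_ord j; lia.
have Hg0 m n : 0 <= n -> iter N mulzw g m n = 0.
  move=> n0; rewrite iter_mulzwE big1 // => j _.
  by rewrite /g [X in Y a _ X]Y_creation ?Y0 ?mul0rz //; lia.
have Hg'0 m n : 0 <= m -> iter N mulzw g' m n = 0.
  move=> n0; rewrite iter_mulzwE big1 // => j _.
  by rewrite /g' [X in Y b _ X]Y_creation ?Y0 ?mul0rz //; lia.
pose H := iter N mulzw g.
have TH m n : T (H m n) = derz H m n + derw H m n.
  have Tg : (fun m n => T (g m n)) = fun m n => derz g m n + derw g m n.
    apply/funext => m'; apply/funext => n'; rewrite /g !Y_translD transl_vacuum.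
    rewrite /derz /derw !(YB, Y0, YMz); module.
  have := iter_mulzw_linear T N g; rewrite Tg iter_mulzw_der.
  by move=> /(congr1 (fun f => f m n)) /= <-.
(* The coefficient of $z^p w^q$ in $H$, times $p!\,q!$: this scaling removes the numerical factors
   from the action of $\partial_z + \partial_w$. *)
pose h (p q : nat) := H (- p%:Z - 1) (- q%:Z - 1) *~ (p`! * q`!)%N%:Z.
have Th p q : T (h p q) = h p.+1 q + h p q.+1.
  rewrite /h translMz TH /derz /derw !factS.
  have -> : - p%:Z - 1 - 1 = - p.+1%:Z - 1 by lia.
  have -> : - q%:Z - 1 - 1 = - q.+1%:Z - 1 by lia.
  rewrite !PoszM !intS.
  module.
(* Since $h(p+1,q) = T h(p,q) - h(p,q+1)$, iterated differences of [G] recover [h]. Absolute values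
   only extend [G] to integer indices; nonnegative ones matter. *)
pose G (m n : int) := iter `|m|%N T (h 0%N `|n|%N).
have GE p : forall m q : nat, iter p mulzw G m q = iter m T (h p q).
  elim: p => [|p IH] m q //=; rewrite /mulzw.
  have -> : m%:Z + 1 = m.+1 by lia.
  have -> : q%:Z + 1 = q.+1 by lia.
  rewrite !IH iterSr Th iter_translD; module.
(* The locality order also bounds the poles: $H(z,0) = z^N Y(a,z)b$ is a power series. *)
have vanish_a n : N%:Z <= n -> Y a n b = 0.
  by move=> le; rewrite -[n](subrK N%:Z) -Hg gg' Hg'0 // subr_ge0.
have vanish_b n : N%:Z <= n -> Y b n a = 0.
  move=> le; apply: (@scalerI _ _ ((-1) ^+ N)); first by rewrite signr_eq0.
  by rewrite -[n](subrK N%:Z) -Hg' -gg' Hg0 ?scaler0 // subr_ge0.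
exists N%:Z => n J leJ.
have [le|gt] := leP N%:Z n.
  rewrite vanish_a // big1 // => j _.
  by rewrite vanish_b ?iter_transl0 ?scaler0 //; lia.
(* With $-p-1 = n-N$, the value $h(p,0)$ is $p!$ times $a_{(n)}b$. *)
pose p := absz (N%:Z - n - 1)%R.
have pE : p%:Z = N%:Z - n - 1 by rewrite /p; lia.
have lepJ : (p.+1 <= J)%N by lia.
rewrite -(big_mkord xpredT (fun j => ((-1) ^ (n + j%:Z + 1) / j`!%:R) *:
  iter j T (Y b (n + j%:Z) a))).
rewrite (big_cat_nat (n := p.+1)) //= [X in _ + X]big_nat_cond.
rewrite [X in _ + X]big1 ?addr0; last first.
  move=> j /andP[/andP[lej _] _].
  by rewrite vanish_b ?iter_transl0 ?scaler0 //; lia.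
rewrite big_mkord.
have := GE p 0%N 0%N; rewrite iter_mulzwE /= {1}/h.
have -> : - p%:Z - 1 = n - N%:Z by lia.
rewrite /H oppr0 add0r Hg subrK fact0 muln1 => e.
apply: (@scalerI _ _ (p`!%:R : K)); first by rewrite pnatr_eq0 -lt0n fact_gt0.
rewrite -[LHS]/(p`!%:~R *: _) scaler_int -e scaler_sumr.
rewrite (reindex_inj rev_ord_inj) /=; apply: eq_bigr => j _.
have lejp : (j <= p)%N by rewrite -ltnS.
rewrite subSS (subKn lejp) !add0r /G !absz_nat /h oppr0 add0r fact0 mul1n.
rewrite /H gg' Hg' bin_sub // -[(_ *: _) *~ _]scaler_int.
rewrite -[iter _ _ _ *~ _]scaler_int !iter_translZ !scalerA.
have -> : - (p - j)%N%:Z - 1 + N%:Z = n + j%:Z by lia.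
congr (_ *: _).
rewrite !rmorphM /= !rmorphXn /= !rmorphN1 -[in RHS](bin_fact lejp) !natrM.
have f0 (k : nat) : k`!%:R != 0 :> K by rewrite pnatr_eq0 -lt0n fact_gt0.
have -> : (-1) ^ (n + j%:Z + 1) = (-1) ^+ (p - j) * (-1) ^+ N :> K.
  rewrite -exprD exprnP; apply: (@signz_parity _ _ _ (- (p - j)%N%:Z)).
  by rewrite PoszD -subzn // pE; lia.
have -> : (p - j)`!%:~R = (p - j)`!%:R :> K by [].
have -> : 'C(p, j)%:~R = 'C(p, j)%:R :> K by [].
by field; exact: f0.
Qed.
End SkewSymmetry.

(** * Weights and opposite modes *)

Section FiniteSums.
Variables (W : zmodType) (I : choiceType).

Lemma fsum_seq (f : I -> W) (r : seq I) : uniq r ->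
  (forall i, i \notin r -> f i = 0) ->
  \sum_(i \in [set: I]) f i = \sum_(i <- r) f i.
Proof.
move=> ur f0; rewrite (@fsbigE _ _ _ _ _ r f ur) //; last first.
  by move=> i _; exact: f0.
by apply: eq_bigl => i; rewrite in_setT.
Qed.

Lemma fsum_seq_ex (f : I -> W) : finite_set [set i | f i != 0] ->
  exists r : seq I, uniq r /\ forall i, i \notin r -> f i = 0.
Proof.
move=> fin; exists (finmap.enum_fset (fset_set [set i | f i != 0])).
split; first exact: finmap.fset_uniq.
move=> i; apply: contraNeq => fi.
by rewrite in_fset_set // inE.
Qed.
End FiniteSums.

Section VOA.
Variables (R : realType) (V : VOA R).
Local Notation K := R[i].
Local Notation T := (@transl R V).
Local Notation Om := (vacuum V).
Local Notation nu := (conformal V).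
Local Notation L := (L V).
Implicit Types a b c v : V.

HB.instance Definition _ n :=
  GRing.isLinear.Build K V V *:%R (L n) (Y_linearr nu (n + 1)).

Lemma LE n v : L n v = Y nu (n + 1) v. Proof. by []. Qed.

Lemma LD n u v : L n (u + v) = L n u + L n v.
Proof. exact: linearD. Qed.
Lemma LB n u v : L n (u - v) = L n u - L n v.
Proof. exact: linearB. Qed.
Lemma LZ n x v : L n (x *: v) = x *: L n v.
Proof. exact: linearZ_LR. Qed.
Lemma L_0 n : L n 0 = 0.
Proof. exact: linear0. Qed.
Lemma L_vacuum n : -1 <= n -> L n Om = 0.
Proof. by move=> n1; rewrite LE Y_creation //; lia. Qed.
Lemma L_transl v : L (-1) v = T v.
Proof. exact: voa_transl. Qed.

Lemma Y_conformal0 v : Y nu 0 v = T v.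
Proof. by rewrite -L_transl LE addNr. Qed.

Lemma iter_LD n l u v : iter l (L n) (u + v) = iter l (L n) u + iter l (L n) v.
Proof. by elim: l => //= l ->; rewrite LD. Qed.
Lemma iter_LZ n l x v : iter l (L n) (x *: v) = x *: iter l (L n) v.
Proof. by elim: l => //= l ->; rewrite LZ. Qed.
Lemma iter_L0 n l : iter l (L n) 0 = 0.
Proof. by elim: l => //= l ->; rewrite L_0. Qed.

Lemma virasoro m n v : m + n != 0 ->
  L m (L n v) = L n (L m v) + L (m + n) v *~ (m - n).
Proof.
move=> mn; have [x /(_ m n v)] := voa_virasoro V.
by rewrite (negPf mn) scale0r addr0 => <-; rewrite addrC subrK.
Qed.

Lemma L0_Y a n b :
  L 0 (Y a n b) = Y a n (L 0 b) + Y (L 0 a) n b - Y a n b *~ (n + 1).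
Proof.
have := commutator_formula nu a 1 n b.
rewrite !big_ord_recl big_ord0 /= /bump /= bin0 bin1 subnn subn0 !mulr1n addr0.
rewrite Y_conformal0 Y_transl_mode addrK addr0 => e.
rewrite !LE !add0r -[LHS](subrK (Y a n (Y nu 1 b))) e; module.
Qed.

(** The modes of $[L_1,Y(a,z)] = Y(L_1a,z) + 2zY(L_0a,z) + z^2\partial_z Y(a,z)$. *)
Lemma L1_Y a n b :
  L 1 (Y a n b) = Y a n (L 1 b) + Y (L 1 a) n b + Y (L 0 a) (n + 1) b *~ 2
                  - Y a (n + 1) b *~ (n + 2).
Proof.
have := commutator_formula nu a 2 n b.
rewrite !big_ord_recl big_ord0 /= /bump /= !addr0.
rewrite Y_conformal0 Y_transl_mode.
have -> : n + (2 - 0)%N%:Z - 1 = n + 1 by lia.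
have -> : n + (2 - 0)%N%:Z = n + 2 by lia.
rewrite !addn0 bin0 bin1 binn /= => e.
rewrite !LE !add0r -[1 + 1]/(2 : int) -[LHS](subrK (Y a n (Y nu 2 b))) e.
module.
Qed.

Lemma wt0 d : wt V d 0.
Proof. by rewrite /wt /eigen_L0 /= -/(L 0) L_0 mul0rz. Qed.

Lemma wtD d u v : wt V d u -> wt V d v -> wt V d (u + v).
Proof.
rewrite /wt /eigen_L0 /= -/(L 0) => eu ev.
by rewrite LD eu ev mulrzDl.
Qed.

Lemma wtZ d x v : wt V d v -> wt V d (x *: v).
Proof.
rewrite /wt /eigen_L0 /= -/(L 0) => ev.
by rewrite LZ ev; module.
Qed.

Lemma wt_Y d e a b n : wt V d a -> wt V e b -> wt V (d + e - n - 1) (Y a n b).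
Proof.
rewrite /wt /eigen_L0 /= -/(L 0) => ea eb.
rewrite L0_Y ea eb YMz YMzl; module.
Qed.

Lemma wt_vacuum : wt V 0 Om.
Proof. by rewrite /wt /eigen_L0 /= -/(L 0) L_vacuum // mulr0z. Qed.

Lemma conformalE : nu = L (-2) Om.
Proof. by rewrite LE Y_creation1. Qed.

Lemma wt_conformal : wt V 2 nu.
Proof.
rewrite /wt /eigen_L0 /= -/(L 0) {1}conformalE virasoro //.
by rewrite [L 0 Om]L_vacuum // L_0 !add0r -conformalE.
Qed.

Lemma L1_conformal : L 1 nu = 0.
Proof.
by rewrite {1}conformalE virasoro // L_vacuum // L_0 add0r L_vacuum // mul0rz.
Qed.

Lemma wt_L d n a : wt V d a -> wt V (d - n) (L n a).
Proof.
move=> wa; have := wt_Y (n + 1) wt_conformal wa.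
by congr (wt V _ _); lia.
Qed.

Lemma wt_iter_L d n l a : wt V d a -> wt V (d - l%:Z * n) (iter l (L n) a).
Proof.
elim: l => [|l IH] wa; first by rewrite mul0r subr0.
have := wt_L n (IH wa); rewrite -iterS.
by congr (wt V _ _); lia.
Qed.

Lemma wt_bounded : exists N, forall n a, n < N -> wt V n a -> a = 0.
Proof.
have [N bN] := voa_bounded V; exists N => n a /bN e.
by rewrite /wt e.
Qed.

(** Reduces additive statements to homogeneous vectors; the empty sum is covered because 0 has every
    weight. *)
Lemma homogeneous_ind (P : V -> Prop) :
  (forall d a, wt V d a -> P a) -> (forall a b, P a -> P b -> P (a + b)) ->
  forall v, P v.
Proof.
move=> Phom PD v; have [f [fin wf ->]] := voa_grading v.
have [r [ur r0]] := fsum_seq_ex fin.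
rewrite (fsum_seq ur r0); apply: big_ind => //; first exact: (Phom 0 _ (wt0 0)).
by move=> d _; exact: Phom (wf d).
Qed.

(** $L_1$ lowers weights by one and weights are bounded below. *)
Lemma L1_nilpotent a : exists N, forall l, (N <= l)%N -> iter l (L 1) a = 0.
Proof.
elim/homogeneous_ind: a => [d a wa|a b [N aN] [N' bN']].
  have [N bN] := wt_bounded; exists (absz (d - N)%R).+1 => l lel.
  by apply: (bN (d - l%:Z * 1)); [lia | exact: wt_iter_L].
exists (N + N')%N => l lel.
by rewrite iter_LD aN ?bN' ?addr0 //; lia.
Qed.

Lemma wt_independent (r : seq int) (f : int -> V) : uniq r ->
  (forall d, wt V d (f d)) -> \sum_(d <- r) f d = 0 ->
  forall d, d \in r -> f d = 0.
Proof.
elim: r f => // e r IH f /= /andP[er ur] wf; rewrite big_cons => s0.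
have fr d : d \in r -> f d = 0.
  move=> dr; have de : d - e != 0.
    by rewrite subr_eq0; apply: contraNneq er => <-.
  (* Applying $L_0 - e$ to the relation removes [f e] and multiplies each other [f d] by $d-e$. *)
  have : (fun d => (d - e)%:~R *: f d) d = 0.
    apply: (IH (fun d => (d - e)%:~R *: f d)) => // [k|]; first exact: wtZ.
    have : L 0 (f e + \sum_(j <- r) f j) - (f e + \sum_(j <- r) f j) *~ e = 0.
      by rewrite s0 L_0 mul0rz subr0.
    rewrite LD linear_sum /= -[L 0 (f e)]/(virasoro_mode nu 0 (f e)) wf.
    move=> e0; rewrite -[RHS]e0 mulrzDl opprD addrACA subrr add0r.
    rewrite mulrz_suml -sumrB /=; apply: eq_bigr => k _.
    have -> : L 0 (f k) = f k *~ k by exact: wf.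
    module.
  by move=> /eqP; rewrite scaler_eq0 intr_eq0 (negPf de) => /eqP.
move=> d; rewrite inE => /orP[/eqP-> |]; last exact: fr.
by move: s0; rewrite big1_seq ?addr0 // => k /andP[_ /fr].
Qed.

(** [wt_comp] rests on a choice of decomposition; uniqueness makes it linear and computable on
    homogeneous vectors. *)
Lemma weight_decomposition_uniq v f g :
  weight_decomposition nu v f -> weight_decomposition nu v g -> f = g.
Proof.
move=> [finf wf vf] [fing wg vg]; apply/funext => d.
have [r [ur r0]] := fsum_seq_ex finf.
have [s [us s0]] := fsum_seq_ex fing.
pose t := undup (r ++ s).
have tf k : k \notin t -> f k = 0.
  by rewrite mem_undup mem_cat negb_or => /andP[/r0].
have tg k : k \notin t -> g k = 0.
  by rewrite mem_undup mem_cat negb_or => /andP[_ /s0].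
have [dt|dt] := boolP (d \in t); last by rewrite tf ?tg.
apply/eqP; rewrite -subr_eq0; apply/eqP.
apply: (@wt_independent t (fun d => f d - g d)) => //; first exact: undup_uniq.
  by move=> k; rewrite -scaleN1r; apply: wtD; [exact: wf | exact/wtZ/wg].
rewrite sumrB -!fsum_seq ?undup_uniq //.
by rewrite -vf -vg subrr.
Qed.

Lemma wt_compP v : weight_decomposition nu v (fun d => wt_comp d v).
Proof. exact: svalP (cid (voa_grading v)). Qed.

Lemma wt_comp_linear d : linear (@wt_comp _ V d).
Proof.
move=> x u v.
have [finu wu eu] := wt_compP u; have [finv wv ev] := wt_compP v.
suff : weight_decomposition nu (x *: u + v)
         (fun d => x *: wt_comp d u + wt_comp d v).
  by move=> /(weight_decomposition_uniq (wt_compP _)) /(congr1 (fun f => f d)).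
have [r [ur r0]] := fsum_seq_ex finu.
have [s [us s0]] := fsum_seq_ex finv.
pose t := undup (r ++ s).
have tu k : k \notin t -> wt_comp k u = 0.
  by rewrite mem_undup mem_cat negb_or => /andP[/r0].
have tv k : k \notin t -> wt_comp k v = 0.
  by rewrite mem_undup mem_cat negb_or => /andP[_ /s0].
have tw k : k \notin t -> x *: wt_comp k u + wt_comp k v = 0.
  by move=> kt; rewrite tu ?tv // scaler0 addr0.
split=> [|k|].
- apply: (@sub_finite_set _ _ [set` t]); last exact: finite_seq.
  by move=> k /=; apply: contraNT => /tw ->.
- exact: (wtD (wtZ x (wu k)) (wv k)).
rewrite (fsum_seq _ tw) ?undup_uniq // {1}eu {1}ev.
rewrite (fsum_seq _ tu) ?(fsum_seq _ tv) ?undup_uniq //.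
by rewrite scaler_sumr -big_split.
Qed.

Lemma wt_comp_homogeneous d e v : wt V e v ->
  wt_comp d v = if d == e then v else 0.
Proof.
move=> wv.
suff : weight_decomposition nu v (fun d => if d == e then v else 0).
  by move=> /(weight_decomposition_uniq (wt_compP _)) /(congr1 (fun f => f d)).
split=> [|k|].
- apply: (@sub_finite_set _ _ [set` [:: e]]); last exact: finite_seq.
  by move=> k /=; rewrite inE; case: ifP => //; rewrite eqxx.
- by case: ifP => [/eqP->//|_]; exact: wt0.
rewrite (@fsum_seq _ _ _ [:: e]) //; last first.
  by move=> i; rewrite inE => /negPf ->.
by rewrite big_seq1 eqxx.
Qed.

End VOA.

(** * Opposite modes as finite sums, and their commutator with $L_1$ *)

Section OppositeModes.
Variables (R : realType) (V : VOA R).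
Local Notation K := R[i].
Local Notation T := (@transl R V).
Local Notation Om := (vacuum V).
Local Notation nu := (conformal V).
Local Notation L := (L V).
Implicit Types a b c v : V.

(** For $p = (l,d)$, the contribution of the weight $d$ component to the coefficient of
    $z^{l-2d}$. *)
Definition opposite_term a (p : nat * int) : V :=
  ((-1) ^ p.2 / (p.1)`!%:R : K) *: iter p.1 (L 1) (wt_comp p.2 a).

Lemma opposite_term_linear p : linear (fun a => opposite_term a p).
Proof.
move=> x u v; rewrite /opposite_term wt_comp_linear iter_LD iter_LZ; module.
Qed.

Lemma opposite_term_seq a : exists r : seq (nat * int),
  uniq r /\ forall p, p \notin r -> opposite_term a p = 0.
Proof.
elim/homogeneous_ind: a => [d a wa|a b [r [ur r0]] [s [us s0]]].
  have [N aN] := L1_nilpotent a; exists [seq (l, d) | l <- iota 0 N].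
  split=> [|[l e]]; first by rewrite map_inj_uniq ?iota_uniq // => l k [].
  rewrite /opposite_term /= (wt_comp_homogeneous _ wa).
  have [->|_] := eqVneq e d; last by rewrite iter_L0 scaler0.
  move=> ld; rewrite aN ?scaler0 // leqNgt; apply: contra ld => lN.
  by apply/map_f; rewrite mem_iota.
exists (undup (r ++ s)); split=> [|p]; first exact: undup_uniq.
rewrite mem_undup mem_cat negb_or => /andP[/r0 ep /s0 eq].
by rewrite -[a]scale1r opposite_term_linear ep eq scaler0 addr0.
Qed.

(** Collapses the two nested sums of finite support into one over any list that carries the
    support. *)
Lemma opposite_modeE a n c (r : seq (nat * int)) : uniq r ->
  (forall p, p \notin r -> opposite_term a p = 0) ->
  opposite_mode a n c =
  \sum_(p <- r) Y (opposite_term a p) (- n - 2 - (p.1%:Z - 2 * p.2)) c.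
Proof.
move=> ur r0; pose phi (p : nat * int) := p.1%:Z - 2 * p.2.
have coefE k :
    exp_L1_L0_coef a k = \sum_(p <- r | phi p == k) opposite_term a p.
  rewrite /exp_L1_L0_coef.
  rewrite (@fsbigE _ _ _ _ _ [seq p <- r | phi p == k]) ?filter_uniq //.
  - rewrite big_filter_cond; apply: eq_bigl => p.
    have [e|//] := eqVneq (phi p) k.
    by apply/mem_set.
  - by move=> p /=; rewrite mem_filter => /andP[/eqP].
  move=> p /= pk; rewrite mem_filter -/(phi p) -[phi p]/(_ - _) pk eqxx /=.
  exact: r0.
pose s := undup (map phi r).
rewrite /opposite_mode (@fsum_seq _ _ _ s) ?undup_uniq //; last first.
  move=> k ks; rewrite coefE big_seq_cond big1 ?Y0l // => p /andP[pr /eqP e].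
  by case/negP: ks; rewrite mem_undup -e map_f.
under eq_bigr do rewrite coefE Ysuml big_mkcond.
rewrite exchange_big /=; apply: eq_big_seq => p pr.
rewrite -/(phi p) (bigD1_seq (phi p)) ?undup_uniq //=; last first.
  by rewrite mem_undup map_f.
rewrite eqxx big1 ?addr0 // => k; rewrite eq_sym => /negPf ->.
by [].
Qed.

Lemma opposite_mode_linear n c : linear (fun a => opposite_mode a n c).
Proof.
move=> x u v.
have [r [ur r0]] := opposite_term_seq u.
have [s [us s0]] := opposite_term_seq v.
pose t := undup (r ++ s).
have tu p : p \notin t -> opposite_term u p = 0.
  by rewrite mem_undup mem_cat negb_or => /andP[/r0].
have tv p : p \notin t -> opposite_term v p = 0.
  by rewrite mem_undup mem_cat negb_or => /andP[_ /s0].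
have tw p : p \notin t -> opposite_term (x *: u + v) p = 0.
  by move=> pt; rewrite opposite_term_linear tu ?tv // scaler0 addr0.
rewrite (opposite_modeE _ _ _ tu) ?undup_uniq //.
rewrite (opposite_modeE _ _ _ tv) ?undup_uniq //.
rewrite (opposite_modeE _ _ _ tw) ?undup_uniq //.
rewrite scaler_sumr -big_split /=; apply: eq_bigr => p _.
by rewrite opposite_term_linear YDl YZl.
Qed.

Lemma opposite_mode_linearr a n : linear (opposite_mode a n).
Proof.
have [r [ur r0]] := opposite_term_seq a.
move=> x u v; rewrite !(opposite_modeE _ _ ur r0) scaler_sumr -big_split /=.
by apply: eq_bigr => p _; rewrite YD YZ.
Qed.

Lemma opposite_mode_homogeneous d N a n c : wt V d a ->
  (forall l, (N <= l)%N -> iter l (L 1) a = 0) ->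
  opposite_mode a n c =
  \sum_(l < N) ((-1) ^ d / l`!%:R) *:
    Y (iter l (L 1) a) (2 * d - l%:Z - n - 2) c.
Proof.
move=> wa aN.
rewrite (@opposite_modeE _ _ _ [seq (l, d) | l <- iota 0 N]).
- rewrite big_map (_ : iota 0 N = index_iota 0 N); last first.
    by rewrite /index_iota subn0.
  rewrite big_mkord.
  apply: eq_bigr => l _; rewrite /opposite_term /=.
  rewrite (wt_comp_homogeneous _ wa) eqxx YZl; congr (_ *: Y _ _ _); lia.
- by rewrite map_inj_uniq ?iota_uniq // => l k [].
move=> [l e]; rewrite /opposite_term /= (wt_comp_homogeneous _ wa).
have [->|_] := eqVneq e d; last by rewrite iter_L0 scaler0.
move=> ld; rewrite aN ?scaler0 // leqNgt; apply: contra ld => lN.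
by apply/map_f; rewrite mem_iota.
Qed.

Lemma opposite_mode_vacuum n c :
  opposite_mode Om n c = if n == -1 then c else 0.
Proof.
rewrite (opposite_mode_homogeneous (N := 1) _ _ (@wt_vacuum R V)); last first.
  by case=> // l _; rewrite iterSr L_vacuum // iter_L0.
rewrite big_ord1 expr0z fact0 divr1 scale1r /= Y_vacuum.
by congr (if _ then _ else _); lia.
Qed.

(** As $\nu$ has weight 2 and $L_1\nu = 0$, passing to opposite modes exchanges $L_k$ and
    $L_{-k}$. *)
Lemma opposite_mode_conformal n c : opposite_mode nu n c = Y nu (2 - n) c.
Proof.
rewrite (opposite_mode_homogeneous (N := 1) _ _ (@wt_conformal R V)); last first.
  by case=> // l _; rewrite iterSr L1_conformal iter_L0.
rewrite big_ord1 fact0 divr1 -exprnP sqrrN expr1n scale1r /=.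
by congr (Y _ _ _); lia.
Qed.

Lemma wt_opposite_mode d e a c n : wt V d a -> wt V e c ->
  wt V (e - d + n + 1) (opposite_mode a n c).
Proof.
move=> wa wc; have [N aN] := L1_nilpotent a.
rewrite (opposite_mode_homogeneous _ _ wa aN).
apply: big_ind => [||l _]; [exact: wt0 | exact: wtD |].
apply: wtZ; have := wt_Y (2 * d - l%:Z - n - 2) (wt_iter_L 1 l wa) wc.
by congr (wt V _ _); lia.
Qed.

(* [L_1, Y^o(a, z)] = - d/dz Y^o(a, z) *)
Lemma L1_opposite_mode a n c :
  L 1 (opposite_mode a n c) =
  opposite_mode a n (L 1 c) + opposite_mode a (n - 1) c *~ n.
Proof.
elim/homogeneous_ind: a n c => [d a wa|a b IHa IHb] n c; last first.
  rewrite -[a]scale1r !opposite_mode_linear !scale1r LD IHa IHb; module.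
have [N0 aN0] := L1_nilpotent a.
have [N aN] : exists N, forall l, (N <= l)%N -> iter l (L 1) a = 0 by exists N0.
have aN1 l : (N.+1 <= l)%N -> iter l (L 1) a = 0.
  by move=> le; apply: aN; rewrite ltnW.
rewrite !(opposite_mode_homogeneous _ _ wa aN1) linear_sum /=.
pose X l := Y (iter l (L 1) a) (2 * d - l%:Z - n - 1) c.
have -> : \sum_(l < N.+1) L 1 (((-1) ^ d / l`!%:R : K) *:
            Y (iter l (L 1) a) (2 * d - l%:Z - n - 2) c) =
  \sum_(l < N.+1) ((-1) ^ d / l`!%:R) *:
     Y (iter l (L 1) a) (2 * d - l%:Z - n - 2) (L 1 c)
  + (\sum_(l < N.+1) ((-1) ^ d / l`!%:R) *: (X l *~ (n - l%:Z))
  + \sum_(l < N.+1) ((-1) ^ d / l`!%:R) *: X l.+1).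
  rewrite -!big_split /=; apply: eq_bigr => l _.
  rewrite LZ L1_Y -!scalerDr; congr (_ *: _).
  have wl := wt_iter_L 1 l wa.
  rewrite (wl : L 0 _ = _) YMzl /X.
  have -> : 2 * d - l%:Z - n - 2 + 1 = 2 * d - l%:Z - n - 1 by lia.
  have -> : 2 * d - l.+1%:Z - n - 1 = 2 * d - l%:Z - n - 2 by lia.
  rewrite /=; module.
congr (_ + _).
rewrite -scaler_int scaler_sumr.
have XN : X N.+1 = 0 by rewrite /X aN1 // Y0l.
(* Shifting $l$ by one in the last sum gives $X_l$ the extra weight $l/l!$, which cancels the $-l$
   in $n-l$ and leaves the factor $n$. *)
rewrite [X in _ + X]big_ord_recr /= XN scaler0 addr0.
rewrite big_ord_recl [RHS]big_ord_recl /=.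
rewrite -addrA -big_split /=; congr (_ + _).
  rewrite /X fact0 divr1 !subr0 /=.
  have -> : 2 * d - n - 1 = 2 * d - (n - 1) - 2 by lia.
  module.
apply: eq_bigr => l _; rewrite /bump /= add1n.
rewrite (_ : Y (L 1 _) _ c = X l.+1); last first.
  by rewrite /X; congr (Y _ _ _); lia.
have -> : ((-1) ^ d / l`!%:R : K) = (-1) ^ d / l.+1`!%:R * l.+1%:R.
  rewrite factS natrM; field.
  by rewrite nat1r !pnatr_eq0 -lt0n fact_gt0.
rewrite intS -[l.+1%:R]nat1r; module.
Qed.

End OppositeModes.

(** * Scalar products and the reflection *)

Section ScalarProduct.
Variables (R : realType) (V : VOA R) (h : V -> V -> R[i]).
Hypothesis hs : scalar_product h.
Local Notation K := R[i].
Implicit Types a b c v : V.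

Lemma hDl a b c : h (a + b) c = h a c + h b c.
Proof. by have [hl _ _] := hs; rewrite -[a]scale1r hl conjC1 mul1r scale1r. Qed.
Lemma hDr a b c : h a (b + c) = h a b + h a c.
Proof. by have [_ hr _] := hs; rewrite -[b]scale1r hr mul1r scale1r. Qed.
Lemma h0l c : h 0 c = 0.
Proof. by apply: (@addrI _ (h 0 c)); rewrite -hDl !addr0. Qed.
Lemma h0r a : h a 0 = 0.
Proof. by apply: (@addrI _ (h a 0)); rewrite -hDr !addr0. Qed.
Lemma hZl x a c : h (x *: a) c = x^* * h a c.
Proof. by have [hl _ _] := hs; rewrite -[x *: a]addr0 hl h0l addr0. Qed.
Lemma hZr x a b : h a (x *: b) = x * h a b.
Proof. by have [_ hr _] := hs; rewrite -[x *: b]addr0 hr h0r addr0. Qed.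
Lemma hNl a c : h (- a) c = - h a c.
Proof. by rewrite -scaleN1r hZl rmorphN1 mulN1r. Qed.
Lemma hNr a c : h a (- c) = - h a c.
Proof. by rewrite -scaleN1r hZr mulN1r. Qed.
Lemma hBl a b c : h (a - b) c = h a c - h b c.
Proof. by rewrite hDl hNl. Qed.
Lemma hBr a b c : h a (b - c) = h a b - h a c.
Proof. by rewrite hDr hNr. Qed.
Lemma hMzl a c (k : int) : h (a *~ k) c = k%:~R * h a c.
Proof. by rewrite -[a *~ k]scaler_int hZl rmorph_int. Qed.
Lemma hMzr a c (k : int) : h a (c *~ k) = k%:~R * h a c.
Proof. by rewrite -[c *~ k]scaler_int hZr. Qed.
Lemma hsuml (I : Type) (r : seq I) (P : pred I) (F : I -> V) c :
  h (\sum_(i <- r | P i) F i) c = \sum_(i <- r | P i) h (F i) c.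
Proof. by apply: (big_morph (h^~ c)) => [u v|]; rewrite ?hDl ?h0l. Qed.
Lemma hsumr (I : Type) (r : seq I) (P : pred I) (F : I -> V) a :
  h a (\sum_(i <- r | P i) F i) = \sum_(i <- r | P i) h a (F i).
Proof. by apply: (big_morph (h a)) => [u v|]; rewrite ?hDr ?h0r. Qed.

Lemma h_self_conj a : (h a a)^* = h a a.
Proof.
have [_ _ pos] := hs; apply: geC0_conj.
by have [->|/pos/ltW//] := eqVneq a 0; rewrite h0l.
Qed.

(** Polarization: the diagonal values at $a+b$ and $a+ib$ are real, which gives two linear relations
    to solve. *)
Lemma h_sym a b : h b a = (h a b)^*.
Proof.
have := h_self_conj (a + b); have := h_self_conj (a + 'i *: b).
rewrite !(hDl, hDr, hZl, hZr) !rmorphD !rmorphM /= !h_self_conj !conjCi.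
set s := h a b; set t := h b a => e2 e1.
have lin (x y z w : K) : x - y = z - w -> z = w -> x = y.
  by move=> e zw; apply/eqP; rewrite -subr_eq0 e zw subrr.
have {}e1 : s^* + t^* = s + t by apply: lin e1; ring.
have {}e2 : s^* - t^* = t - s.
  have i0 : 'i != 0 :> K by rewrite neq0Ci.
  apply: (mulfI i0); move: e2; rewrite rmorphN /= conjCi opprK => e2.
  by apply: lin (esym e2); ring.
apply: (@mulfI _ 2%:R); first by rewrite pnatr_eq0.
have e : (s^* + t^*) + (s^* - t^*) = (s + t) + (t - s) by rewrite e1 e2.
by apply/esym; apply: lin e; ring.
Qed.

Lemma h_nondegenerate a : (forall c, h a c = 0) -> a = 0.
Proof.
have [_ _ pos] := hs => a0; apply/eqP; apply: contraT => /pos.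
by rewrite a0 ltxx.
Qed.

Lemma h_injl a b : (forall c, h a c = h b c) -> a = b.
Proof.
move=> ab; apply/eqP; rewrite -subr_eq0; apply/eqP.
by apply: h_nondegenerate => c; rewrite hBl ab subrr.
Qed.

Lemma h_injl_homogeneous a b :
  (forall d c, wt V d c -> h a c = h b c) -> a = b.
Proof.
move=> ab; apply: h_injl; apply: homogeneous_ind => // c c' e e'.
by rewrite !hDr e e'.
Qed.
End ScalarProduct.

(** For homogeneous [a], the index $-m-2$ turns the opposite modes into a finite combination of
    fields $z^k Y(L_1^l a,z)$. *)
Lemma opposite_mode_local (R : realType) (V : VOA R) (a b : V) :
  mutually_local (fun m => opposite_mode a (- m - 2)) (Y b).
Proof.
elim/homogeneous_ind: a => [d a wa|a a' loc loc'].
  have [N aN] := L1_nilpotent a.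
  have locl (l : 'I_N) := mutually_local_shift (2 * d - l%:Z)
    (Y_local (iter l (L V 1) a) b).
  apply: mutually_local_eq (mutually_local_sum (index_enum _)
    (fun l : 'I_N => (-1) ^ d / l`!%:R) (Y_linearr b) locl) => n v.
  rewrite (opposite_mode_homogeneous _ _ wa aN); apply: eq_bigr => l _.
  by congr (_ *: Y _ _ _); lia.
apply: mutually_local_eq (mutually_local_lin 1 (Y_linearr b) loc loc') => n v.
by rewrite -[in RHS](scale1r a) opposite_mode_linear.
Qed.

(** * From an invariant scalar product to Möbius symmetry and local adjoints *)

Section UnitaryImpliesLocalAdjoints.
Variables (R : realType) (V : VOA R) (h : V -> V -> R[i]).
Hypothesis hs : scalar_product h.

Lemma invariant_moebius_local : invariant_scalar_product h ->
  unitary_moebius_symmetry h /\ local_adjoint_set h = [set: V].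
Proof.
move=> [_ [theta [[antilin [theta' thetaK thetaK'] thetaM theta_nu] [_ inv]]]].
(* Substituting $b = \theta(\theta^{-1}b)$ turns invariance of the bilinear form into an adjunction
   for the scalar product. *)
have {}inv a n b c : h (Y (theta a) n b) c = h b (opposite_mode a n c).
  by rewrite -[b]thetaK' -thetaM inv.
split=> [n _ a b|].
  rewrite /L /virasoro_mode -{1}theta_nu inv opposite_mode_conformal.
  by congr (h _ (Y _ _ _)); lia.
apply/seteqP; split=> // a _.
exists (opposite_mode (theta' a)); split=> [n|b].
  split=> [|b c]; first exact: opposite_mode_linearr.
  by rewrite -[a in LHS]thetaK' (h_sym hs) inv -(h_sym hs).
exact: opposite_mode_local.
Qed.
End UnitaryImpliesLocalAdjoints.

(** * Construction of the reflection from local adjoints *)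

Section AdjointVertexOperators.
Variables (R : realType) (V : VOA R) (h : V -> V -> R[i]).
Hypotheses (hs : scalar_product h) (moebius : unitary_moebius_symmetry h).
Hypothesis local_adjoints : forall a, has_local_adjoint h a.
Local Notation K := R[i].
Local Notation T := (@transl R V).
Local Notation Om := (vacuum V).
Local Notation nu := (conformal V).
Local Notation L := (L V).
Implicit Types a b c v : V.

Lemma L0_adjoint a b : h (L 0 a) b = h a (L 0 b).
Proof. by rewrite moebius // oppr0. Qed.
Lemma L1_adjoint a b : h (L 1 a) b = h a (T b).
Proof. by rewrite moebius // L_transl. Qed.
Lemma transl_adjoint a b : h (T a) b = h a (L 1 b).
Proof. by rewrite -L_transl moebius // opprK. Qed.

(** $L_0$ is self-adjoint with integer eigenvalues. *)
Lemma wt_orthogonal d e a b : wt V d a -> wt V e b -> d != e -> h a b = 0.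
Proof.
move=> wa wb de; have := L0_adjoint a b.
rewrite (wa : L 0 a = _) (wb : L 0 b = _) (hMzl hs) (hMzr hs) => /eqP.
rewrite -subr_eq0 -mulrBl -rmorphB mulf_eq0 intr_eq0 subr_eq0 (negPf de).
by move=> /eqP.
Qed.

(** Reads off the weight of a vector that is known only through its scalar products. *)
Lemma wt_orthogonalP d a :
  (forall e c, wt V e c -> e != d -> h a c = 0) -> wt V d a.
Proof.
move=> orth; apply: (h_injl_homogeneous hs) => e c wc.
rewrite -/(L 0 a) L0_adjoint (wc : L 0 c = _) (hMzl hs) (hMzr hs).
by have [->|ed] := eqVneq e d; rewrite ?(orth e c wc ed) ?mulr0.
Qed.

(** An opposite mode is a finite combination of modes of the $L_1^l a$, so its adjoint is the
    conjugate combination of their local adjoints. *)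
Lemma adjoint_opposite_homogeneous d a : wt V d a ->
  exists X : int -> V -> V,
    (forall n b c, h (X n b) c = h b (opposite_mode a n c)) /\
    forall b, mutually_local X (Y b).
Proof.
move=> wa; have [N aN] := L1_nilpotent a.
pose ad l := sval (cid (local_adjoints (iter l (L 1) a))).
have ad_adj l : forall m, adjoint_of h (ad l m) (Y (iter l (L 1) a) m).
  by rewrite /ad; case: (cid _) => ? [].
have ad_loc l : forall b, mutually_local (fun m => ad l (- m - 2)) (Y b).
  by rewrite /ad; case: (cid _) => ? [].
exists (fun n v => \sum_(l < N) ((-1) ^ d / l`!%:R : K)^* *:
                     ad l (2 * d - l%:Z - n - 2) v); split=> [n b c|b].
  rewrite (opposite_mode_homogeneous _ _ wa aN) (hsuml hs) (hsumr hs).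
  apply: eq_bigr => l _; rewrite (hZl hs) (hZr hs) conjCK; congr (_ * _).
  by have [_ ->] := ad_adj l (2 * d - l%:Z - n - 2).
have locl (l : 'I_N) := mutually_local_shift (l%:Z - 2 * d) (ad_loc l b).
apply: mutually_local_eq (mutually_local_sum (index_enum _)
  (fun l : 'I_N => ((-1) ^ d / l`!%:R)^*) (Y_linearr b) locl) => n v.
by apply: eq_bigr => l _; congr (_ *: ad _ _ _); lia.
Qed.

Lemma adjoint_opposite_vertex a :
  exists x, forall n b c, h (Y x n b) c = h b (opposite_mode a n c).
Proof.
elim/homogeneous_ind: a => [d a wa|a a' [x xP] [x' xP']]; last first.
  exists (x + x') => n b c; rewrite YDl (hDl hs) xP xP' -(hDr hs).
  by rewrite -{2}[a]scale1r opposite_mode_linear scale1r.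
have [X [XP Xloc]] := adjoint_opposite_homogeneous wa.
(* Adjoint form of the commutator of $L_1$ with the opposite field, tested against $\Omega$. *)
have TX n : T (X n Om) = - (X (n - 1) Om *~ n).
  apply: (h_injl hs) => c; rewrite transl_adjoint XP.
  have := L1_opposite_mode a n c => /(congr1 (h Om)).
  rewrite (hDr hs) -transl_adjoint transl_vacuum (h0l hs) (hMzr hs) => e.
  rewrite (hNl hs) (hMzl hs) XP; apply/eqP.
  by rewrite -addr_eq0 -e.
(* $X_n\Omega$ has weight $d-n-1$, hence vanishes for large $n$, and covariance removes the
   remaining negative powers. *)
have X0 n : 0 <= n -> X n Om = 0.
  apply: (transl_covariant_nonneg TX); have [M bM] := wt_bounded V.
  exists (d - M) => m le; apply: (bM (d - m - 1)); first lia.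
  apply: wt_orthogonalP => e c wc ne; rewrite XP.
  apply: wt_orthogonal (@wt_vacuum _ V) (wt_opposite_mode m wa wc) _.
  by apply: contraNneq ne => ?; apply/eqP; lia.
exists (X (-1) Om) => n b c; rewrite -XP; congr (h _ _).
apply/eqP; rewrite -subr_eq0; apply/eqP.
pose D n v := Y (X (-1) Om) n v - X n v.
rewrite -/(D n b); apply: local_annihilating_vacuum n.
- apply: mutually_local_eq (mutually_local_lin (-1) (Y_linearr b)
    (Xloc b) (Y_local (X (-1) Om) b)) => n v.
  by rewrite /D; module.
- move=> n; rewrite /D Y0 sub0r; apply/eqP; rewrite oppr_eq0; apply/eqP.
  by apply: (h_nondegenerate hs) => v; rewrite XP (h0l hs).
apply: transl_covariant_vacuum => n.
  by rewrite /D translB transl_Y_vacuum TX; module.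
move=> n1; rewrite /D; have [->|nn1] := eqVneq n (-1).
  by rewrite Y_creation1 subrr.
by rewrite Y_creation ?X0 ?subrr //; lia.
Qed.

Definition theta a : V := sval (cid (adjoint_opposite_vertex a)).

Lemma thetaP a n b c : h (Y (theta a) n b) c = h b (opposite_mode a n c).
Proof. exact: (svalP (cid (adjoint_opposite_vertex a))). Qed.

Lemma h_theta a c : h (theta a) c = h Om (opposite_mode a (-1) c).
Proof. by rewrite -thetaP Y_creation1. Qed.

Lemma theta_antilinear (x : K) a b :
  theta (x *: a + b) = x^* *: theta a + theta b.
Proof.
apply: (h_injl hs) => c; rewrite h_theta opposite_mode_linear.
by rewrite (hDl hs) (hDr hs) (hZl hs) (hZr hs) conjCK -!h_theta.
Qed.

Lemma thetaD a b : theta (a + b) = theta a + theta b.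
Proof. by rewrite -[a]scale1r theta_antilinear conjC1 !scale1r. Qed.

Lemma theta_vacuum : theta Om = Om.
Proof.
by apply: (h_injl hs) => c; rewrite h_theta opposite_mode_vacuum.
Qed.

Lemma wt_theta d a : wt V d a -> wt V d (theta a).
Proof.
move=> wa; apply: wt_orthogonalP => e c wc ed; rewrite h_theta.
apply: wt_orthogonal (@wt_vacuum _ V) (wt_opposite_mode (-1) wa wc) _.
by apply: contraNneq ed => ?; apply/eqP; lia.
Qed.

(** Paired with [c], both sides become combinations of the numbers [u l]; they differ by $2d-1$
    times a sum that vanishes because $(\theta a)_{(0)}\Omega = 0$. *)
Lemma theta_L1 a : theta (L 1 a) = L 1 (theta a).
Proof.
elim/homogeneous_ind: a => [d a wa|a b ea eb]; last first.
  by rewrite LD !thetaD ea eb LD.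
have [N aN] := L1_nilpotent a.
apply: (h_injl hs) => c; rewrite L1_adjoint !h_theta.
have wa1 : wt V (d - 1) (L 1 a) := wt_L 1 wa.
have aN1 l : (N <= l)%N -> iter l (L 1) (L 1 a) = 0.
  by move=> le; rewrite -iterSr aN // ltnW.
have aN' l : (N.+1 <= l)%N -> iter l (L 1) a = 0.
  by move=> le; rewrite aN // ltnW.
pose u l := h Om (Y (iter l (L 1) a) (2 * d - l%:Z - 2) c).
have uN : u N = 0 by rewrite /u aN // Y0l (h0r hs).
have sum0 : \sum_(l < N.+1) ((-1) ^ d / l`!%:R : K) * u l = 0.
  have := thetaP a 0 Om c; rewrite Y_creation // (h0l hs).
  rewrite (opposite_mode_homogeneous _ _ wa aN') (hsumr hs) => /esym e.
  rewrite -[RHS]e; apply: eq_bigr => l _; rewrite (hZr hs) /u subr0.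
  by [].
rewrite (opposite_mode_homogeneous _ _ wa1 aN1).
rewrite (opposite_mode_homogeneous _ _ wa aN') !(hsumr hs).
(* $\Omega$ is orthogonal to the image of $T$, so inside $(\Omega|\cdot)$ the operator $T$ on [c]
   only lowers the mode and produces its index as a factor. *)
have hT v : h Om (T v) = 0 by rewrite -L1_adjoint L_vacuum // (h0l hs).
transitivity (- \sum_(l < N.+1) ((-1) ^ d / l`!%:R : K) * l%:R * u l).
  rewrite big_ord_recl mulr0 mul0r add0r -sumrN; apply: eq_bigr => l _.
  rewrite (hZr hs) -iterSr /u.
  have -> : 2 * (d - 1) - l%:Z - -1 - 2 = 2 * d - l.+1%:Z - 2 by lia.
  rewrite -mulNr; congr (_ * _).
  rewrite lift0 exprzDr ?unitrN1 // exprN1 invrN1 factS natrM.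
  field; by rewrite ?nat1r !pnatr_eq0 -lt0n fact_gt0.
transitivity ((2 * d - 1)%:~R * (\sum_(l < N.+1) ((-1) ^ d / l`!%:R : K) * u l)
   - \sum_(l < N.+1) ((-1) ^ d / l`!%:R : K) * l%:R * u l).
  by rewrite sum0 mulr0 sub0r.
rewrite mulr_sumr -sumrB; apply: eq_bigr => l _.
rewrite (hZr hs).
have -> : 2 * d - l%:Z - -1 - 2 = 2 * d - l%:Z - 1 by lia.
have := Y_transl (iter l (L 1) a) (2 * d - l%:Z - 1) c.
move=> /(congr1 (h Om)); rewrite (hBr hs) hT sub0r (hNr hs) (hMzr hs) => e.
rewrite (oppr_inj e).
have -> : 2 * d - l%:Z - 1 - 1 = 2 * d - l%:Z - 2 by lia.
rewrite -/(u l) !rmorphB /=.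
ring.
Qed.

End AdjointVertexOperators.

(** * The operators $e^{xL_1}$ and $(-1)^{L_0}$ *)

Section ExponentialAndSign.
Variables (R : realType) (V : VOA R).
Local Notation K := R[i].
Local Notation L := (L V).
Implicit Types a b c v : V.

(** $e^{xL_1}a$, cut off at a chosen nilpotency bound; [expL1E] removes the dependence on that
    choice. *)
Definition expL1 (x : K) a : V :=
  \sum_(l < sval (cid (L1_nilpotent a))) (x ^+ l / l`!%:R) *: iter l (L 1) a.

Lemma expL1E x a N : (forall l, (N <= l)%N -> iter l (L 1) a = 0) ->
  expL1 x a = \sum_(l < N) (x ^+ l / l`!%:R) *: iter l (L 1) a.
Proof.
rewrite /expL1; case: (cid _) => M /= aM aN.
have widen k k' : (k <= k')%N -> (forall l, (k <= l)%N -> iter l (L 1) a = 0) ->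
    \sum_(l < k) (x ^+ l / l`!%:R) *: iter l (L 1) a =
    \sum_(l < k') (x ^+ l / l`!%:R) *: iter l (L 1) a.
  move=> le ak.
  rewrite (big_ord_widen k' (fun l => (x ^+ l / l`!%:R) *: iter l (L 1) a) le).
  rewrite big_mkcond; apply: eq_bigr => l _; case: ltnP => // kl.
  by rewrite ak // scaler0.
by rewrite (widen _ _ (leq_maxl M N) aM) (widen _ _ (leq_maxr M N) aN).
Qed.

Lemma expL1_linear x : linear (expL1 x).
Proof.
move=> y u v; have [N uN] := L1_nilpotent u; have [M vM] := L1_nilpotent v.
have uN' l : (N + M <= l)%N -> iter l (L 1) u = 0 by move=> le; apply: uN; lia.
have vM' l : (N + M <= l)%N -> iter l (L 1) v = 0 by move=> le; apply: vM; lia.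
have w l : (N + M <= l)%N -> iter l (L 1) (y *: u + v) = 0.
  by move=> le; rewrite iter_LD iter_LZ uN' ?vM' // scaler0 addr0.
rewrite (expL1E _ uN') (expL1E _ vM') (expL1E _ w) scaler_sumr -big_split.
apply: eq_bigr => l _; rewrite /= iter_LD iter_LZ; module.
Qed.

Lemma expL1D x u v : expL1 x (u + v) = expL1 x u + expL1 x v.
Proof. by rewrite -[u]scale1r expL1_linear !scale1r. Qed.

(** The degree $m$ coefficient of $e^{-x}e^{x}$, that is $(1-1)^m/m!$. *)
Lemma exp_inverse_coef m :
  \sum_(k < m.+1) ((-1) ^+ k / (k`! * (m - k)`!)%:R : K) = (m == 0%N)%:R.
Proof.
have f0 (k : nat) : k`!%:R != 0 :> K by rewrite pnatr_eq0 -lt0n fact_gt0.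
apply: (mulIf (f0 m)).
transitivity ((1 - 1) ^+ m : K); last first.
  by rewrite subrr expr0n; case: m => [|m]; rewrite ?mul1r ?fact0 ?mul0r.
rewrite exprDn mulr_suml; apply: eq_bigr => k _.
have le : (k <= m)%N by rewrite -ltnS.
rewrite expr1n mul1r -(bin_fact le) -mulr_natr !natrM.
by field; rewrite !f0.
Qed.

Lemma expL1K a : expL1 1 (expL1 (-1) a) = a.
Proof.
have [N aN] := L1_nilpotent a.
have aN' l : (N.+1 <= l)%N -> iter l (L 1) a = 0 by move=> /ltnW; exact: aN.
have iter_sum l (r : seq nat) (x : nat -> K) : iter l (L 1)
    (\sum_(k <- r) x k *: iter k (L 1) a) =
    \sum_(k <- r) x k *: iter (l + k) (L 1) a.
  elim: r => [|k r IH]; first by rewrite !big_nil iter_L0.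
  by rewrite !big_cons iter_LD iter_LZ IH -iterD.
rewrite (expL1E (-1) aN') -(big_mkord xpredT
  (fun k => ((-1) ^+ k / k`!%:R) *: iter k (L 1) a)).
rewrite (@expL1E _ _ N.+1) => [|l le]; last first.
  rewrite iter_sum big1 // => k _; rewrite aN' ?scaler0 //; lia.
transitivity (\sum_(l < N.+1) \sum_(k < N.+1) (1 ^+ l / l`!%:R : K) *:
    (((-1) ^+ k / k`!%:R) *: iter (l + k) (L 1) a)).
  by apply: eq_bigr => l _; rewrite iter_sum scaler_sumr big_mkord.
(* Regroup by total degree $m = l+k$; pairs beyond the bound contribute zero. *)
have E (l k : 'I_N.+1) : (1 ^+ l / l`!%:R : K) *: (((-1) ^+ k / k`!%:R) *:
      iter (l + k) (L 1) a) =
    \sum_(m < N.+1 | (k <= m)%N && (l == m - k :> nat)%N)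
      ((-1) ^+ k / (k`! * (m - k)`!)%:R) *: iter m (L 1) a.
  have [le|gt] := leqP N.+1 (l + k)%N.
    rewrite aN' // !scaler0 big1 // => m /andP[km /eqP lm].
    by have := ltn_ord m; lia.
  rewrite (big_pred1 (Ordinal gt)) /= => [|m].
    rewrite addnK scalerA expr1n natrM; congr (_ *: _).
    by field; rewrite !pnatr_eq0 -!lt0n !fact_gt0.
  by apply/idP/eqP => [/andP[? /eqP ?]|->];
    [apply: val_inj => /=; lia | rewrite /=; lia].
under eq_bigr => l _ do under eq_bigr => k _ do rewrite E.
rewrite exchange_big /=.
transitivity (\sum_(m < N.+1) (\sum_(k < m.+1)
   ((-1) ^+ k / (k`! * (m - k)`!)%:R : K)) *: iter m (L 1) a); last first.
  rewrite big_ord_recl exp_inverse_coef scale1r big1 ?addr0 // => m _.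
  by rewrite exp_inverse_coef scale0r.
transitivity (\sum_(k < N.+1) \sum_(m < N.+1 | (k <= m)%N)
   ((-1) ^+ k / (k`! * (m - k)`!)%:R : K) *: iter m (L 1) a).
  apply: eq_bigr => k _.
  rewrite (exchange_big_dep (fun m : 'I__ => k <= m)%N) /=.
    apply: eq_bigr => m km.
    have lt : (m - k < N.+1)%N by have := ltn_ord m; lia.
    rewrite (big_pred1 (Ordinal lt)) // => l /=.
    by rewrite km /=; apply/eqP/eqP => [?|->//]; apply: val_inj.
  by move=> l m _ /andP[].
rewrite (exchange_big_dep xpredT) //=; apply: eq_bigr => m _.
rewrite scaler_suml (big_ord_widen N.+1
  (fun k => ((-1) ^+ k / (k`! * (m - k)`!)%:R : K) *: iter m (L 1) a)) //.
Qed.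

Definition sgnL0 a : V := \sum_(d \in [set: int]) ((-1) ^ d : K) *: wt_comp d a.

Lemma sgnL0E a (r : seq int) : uniq r ->
  (forall d, d \notin r -> wt_comp d a = 0) ->
  sgnL0 a = \sum_(d <- r) ((-1) ^ d : K) *: wt_comp d a.
Proof.
by move=> ur r0; rewrite /sgnL0 (fsum_seq ur) // => d /r0 ->; rewrite scaler0.
Qed.

Lemma sgnL0_linear : linear sgnL0.
Proof.
move=> x u v.
have [/fsum_seq_ex[r [ur r0]] _ _] := wt_compP u.
have [/fsum_seq_ex[s [us s0]] _ _] := wt_compP v.
pose t := undup (r ++ s).
have tu k : k \notin t -> wt_comp k u = 0.
  by rewrite mem_undup mem_cat negb_or => /andP[/r0].
have tv k : k \notin t -> wt_comp k v = 0.
  by rewrite mem_undup mem_cat negb_or => /andP[_ /s0].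
have tw k : k \notin t -> wt_comp k (x *: u + v) = 0.
  by move=> kt; rewrite wt_comp_linear tu ?tv // scaler0 addr0.
rewrite (sgnL0E _ tu) ?undup_uniq // (sgnL0E _ tv) ?undup_uniq //.
rewrite (sgnL0E _ tw) ?undup_uniq // scaler_sumr -big_split.
apply: eq_bigr => d _; rewrite /= wt_comp_linear; module.
Qed.

Lemma sgnL0D u v : sgnL0 (u + v) = sgnL0 u + sgnL0 v.
Proof. by rewrite -[u]scale1r sgnL0_linear !scale1r. Qed.

Lemma sgnL0_0 : sgnL0 0 = 0.
Proof. by apply: (@addrI _ (sgnL0 0)); rewrite -sgnL0D !addr0. Qed.

Lemma sgnL0Z x u : sgnL0 (x *: u) = x *: sgnL0 u.
Proof. by rewrite -[x *: u]addr0 sgnL0_linear sgnL0_0 addr0. Qed.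

Lemma sgnL0_sum (I : Type) (r : seq I) (P : pred I) (F : I -> V) :
  sgnL0 (\sum_(i <- r | P i) F i) = \sum_(i <- r | P i) sgnL0 (F i).
Proof. by apply: (big_morph sgnL0) => [u v|]; rewrite ?sgnL0D ?sgnL0_0. Qed.

Lemma sgnL0_homogeneous d v : wt V d v -> sgnL0 v = (-1) ^ d *: v.
Proof.
move=> wv; rewrite (@sgnL0E _ [:: d]) // => [|e].
  by rewrite big_seq1 (wt_comp_homogeneous _ wv) eqxx.
by rewrite inE (wt_comp_homogeneous _ wv) => /negPf ->.
Qed.

Lemma expL1_0 x : expL1 x 0 = 0.
Proof. by apply: (@addrI _ (expL1 x 0)); rewrite -expL1D !addr0. Qed.

Lemma expL1Z x y u : expL1 x (y *: u) = y *: expL1 x u.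
Proof. by rewrite -[y *: u]addr0 expL1_linear expL1_0 addr0. Qed.

Lemma sgnL0K v : sgnL0 (sgnL0 v) = v.
Proof.
elim/homogeneous_ind: v => [d v wv|u v eu ev]; last by rewrite !sgnL0D eu ev.
rewrite (sgnL0_homogeneous wv) sgnL0Z (sgnL0_homogeneous wv) scalerA.
rewrite -exprzDr ?unitrN1 // (@signz_parity _ _ 0 d) ?expr0z ?scale1r //; lia.
Qed.

(** $L_1$ shifts weights by one, so conjugation by $(-1)^{L_0}$ changes its sign. *)
Lemma sgnL0_expL1 v : sgnL0 (expL1 1 (sgnL0 v)) = expL1 (-1) v.
Proof.
elim/homogeneous_ind: v => [d v wv|u v eu ev].
  have [N vN] := L1_nilpotent v.
  rewrite (sgnL0_homogeneous wv) expL1Z !(expL1E _ vN) sgnL0Z sgnL0_sum.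
  rewrite scaler_sumr; apply: eq_bigr => l _.
  rewrite sgnL0Z (sgnL0_homogeneous (wt_iter_L 1 l wv)) !scalerA.
  congr (_ *: _); rewrite expr1n div1r mulrAC -exprzDr ?unitrN1 //.
  congr (_ * _); rewrite exprnP.
  by apply: (@signz_parity _ _ _ (d - l%:Z)); lia.
by rewrite !(sgnL0D, expL1D) eu ev.
Qed.

(** $e^{L_1}(-1)^{L_0}$ is the operator $e^{zL_1}(-z^{-2})^{L_0}$ at $z=1$. *)
Lemma expL1_sgnL0K v : expL1 1 (sgnL0 (expL1 1 (sgnL0 v))) = v.
Proof. by rewrite sgnL0_expL1 expL1K. Qed.

End ExponentialAndSign.

(** * Three-point functions and multiplicativity of the reflection *)

Section Reflection.
Variables (R : realType) (V : VOA R) (h : V -> V -> R[i]).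
Hypotheses (hs : scalar_product h) (moebius : unitary_moebius_symmetry h).
Local Notation K := R[i].
Local Notation T := (@transl R V).
Local Notation Om := (vacuum V).
Local Notation nu := (conformal V).
Local Notation L := (L V).
Local Notation e := (expL1 (V := V) 1).
Local Notation e' := (expL1 (V := V) (-1)).
Local Notation s := (@sgnL0 R V).
Implicit Types a b c v : V.

(* (b | Y(a, 1) c) *)
Definition pairing b a c : K := \sum_(n \in [set: int]) h b (Y a n c).

(** Orthogonality of weight spaces leaves a single mode for homogeneous arguments, so the sum
    defining [pairing] is finite. *)
Lemma pairing_seq b a c :
  exists r : seq int, uniq r /\ forall n, n \notin r -> h b (Y a n c) = 0.
Proof.
elim/homogeneous_ind: a => [d a wa|a a' [r [ur r0]] [r' [ur' r0']]]; last first.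
  exists (undup (r ++ r')); split=> [|n]; first exact: undup_uniq.
  rewrite mem_undup mem_cat negb_or => /andP[/r0 ea /r0' ea'].
  by rewrite YDl (hDr hs) ea ea' addr0.
elim/homogeneous_ind: b => [f b wb|b b' [r [ur r0]] [r' [ur' r0']]]; last first.
  exists (undup (r ++ r')); split=> [|n]; first exact: undup_uniq.
  rewrite mem_undup mem_cat negb_or => /andP[/r0 ea /r0' ea'].
  by rewrite (hDl hs) ea ea' addr0.
elim/homogeneous_ind: c => [g c wc|c c' [r [ur r0]] [r' [ur' r0']]]; last first.
  exists (undup (r ++ r')); split=> [|n]; first exact: undup_uniq.
  rewrite mem_undup mem_cat negb_or => /andP[/r0 ea /r0' ea'].
  by rewrite YD (hDr hs) ea ea' addr0.
exists [:: d + g - f - 1]; split=> // n; rewrite inE => ne.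
apply: (wt_orthogonal hs moebius wb (wt_Y n wa wc)).
by apply: contraNneq ne => ?; apply/eqP; lia.
Qed.

Lemma pairing_homogeneous f d g b a c : wt V f b -> wt V d a -> wt V g c ->
  pairing b a c = h b (Y a (d + g - f - 1) c).
Proof.
move=> wb wa wc; rewrite /pairing (@fsum_seq _ _ _ [:: d + g - f - 1]) //.
  by rewrite big_seq1.
move=> n; rewrite inE => ne.
apply: (wt_orthogonal hs moebius wb (wt_Y n wa wc)).
by apply: contraNneq ne => ?; apply/eqP; lia.
Qed.

(** One statement from which linearity in each of the three arguments follows. *)
Lemma pairing_comb (x : K) b1 a1 c1 b2 a2 c2 b3 a3 c3 :
  (forall n, h b3 (Y a3 n c3) = x * h b1 (Y a1 n c1) + h b2 (Y a2 n c2)) ->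
  pairing b3 a3 c3 = x * pairing b1 a1 c1 + pairing b2 a2 c2.
Proof.
move=> E; have [r1 [ur1 r1P]] := pairing_seq b1 a1 c1.
have [r2 [ur2 r2P]] := pairing_seq b2 a2 c2.
pose t := undup (r1 ++ r2); have ut : uniq t := undup_uniq _.
have t1 k : k \notin t -> h b1 (Y a1 k c1) = 0.
  by rewrite mem_undup mem_cat negb_or => /andP[/r1P].
have t2 k : k \notin t -> h b2 (Y a2 k c2) = 0.
  by rewrite mem_undup mem_cat negb_or => /andP[_ /r2P].
rewrite /pairing (fsum_seq ut t1) (fsum_seq ut t2) (fsum_seq ut) => [|k kt].
  by rewrite mulr_sumr -big_split; apply: eq_bigr => n _.
by rewrite E t1 // t2 // mulr0 addr0.
Qed.

Lemma pairingDl b b' a c :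
  pairing (b + b') a c = pairing b a c + pairing b' a c.
Proof.
rewrite -[pairing b a c]mul1r; apply: pairing_comb => n.
by rewrite (hDl hs) mul1r.
Qed.
Lemma pairingDm b a a' c :
  pairing b (a + a') c = pairing b a c + pairing b a' c.
Proof.
rewrite -[pairing b a c]mul1r; apply: pairing_comb => n.
by rewrite YDl (hDr hs) mul1r.
Qed.
Lemma pairingDr b a c c' :
  pairing b a (c + c') = pairing b a c + pairing b a c'.
Proof.
rewrite -[pairing b a c]mul1r; apply: pairing_comb => n.
by rewrite YD (hDr hs) mul1r.
Qed.
Lemma pairing0m b c : pairing b 0 c = 0.
Proof. by apply: (@addrI _ (pairing b 0 c)); rewrite -pairingDm !addr0. Qed.
Lemma pairing0r b a : pairing b a 0 = 0.
Proof. by apply: (@addrI _ (pairing b a 0)); rewrite -pairingDr !addr0. Qed.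
Lemma pairing0l a c : pairing 0 a c = 0.
Proof. by apply: (@addrI _ (pairing 0 a c)); rewrite -pairingDl !addr0. Qed.
Lemma pairingZl x b a c : pairing (x *: b) a c = x^* * pairing b a c.
Proof.
rewrite -[RHS]addr0 -[X in _ = _ + X](pairing0l a c); apply: pairing_comb => n.
by rewrite (hZl hs) (h0l hs) addr0.
Qed.
Lemma pairingZm x b a c : pairing b (x *: a) c = x * pairing b a c.
Proof.
rewrite -[RHS]addr0 -[X in _ = _ + X](pairing0l a c); apply: pairing_comb => n.
by rewrite YZl (hZr hs) (h0l hs) addr0.
Qed.
Lemma pairingZr x b a c : pairing b a (x *: c) = x * pairing b a c.
Proof.
rewrite -[RHS]addr0 -[X in _ = _ + X](pairing0l a c); apply: pairing_comb => n.
by rewrite YZ (hZr hs) (h0l hs) addr0.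
Qed.
Lemma pairing_suml (I : Type) (r : seq I) (P : pred I) (F : I -> V) a c :
  pairing (\sum_(i <- r | P i) F i) a c = \sum_(i <- r | P i) pairing (F i) a c.
Proof.
by apply: (big_morph (fun b => pairing b a c)) => [u v|];
  rewrite ?pairingDl ?pairing0l.
Qed.
Lemma pairing_summ (I : Type) (r : seq I) (P : pred I) (F : I -> V) b c :
  pairing b (\sum_(i <- r | P i) F i) c = \sum_(i <- r | P i) pairing b (F i) c.
Proof.
by apply: (big_morph (fun a => pairing b a c)) => [u v|];
  rewrite ?pairingDm ?pairing0m.
Qed.
Lemma pairing_sumr (I : Type) (r : seq I) (P : pred I) (F : I -> V) b a :
  pairing b a (\sum_(i <- r | P i) F i) = \sum_(i <- r | P i) pairing b a (F i).
Proof.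
by apply: (big_morph (pairing b a)) => [u v|]; rewrite ?pairingDr ?pairing0r.
Qed.

(** At $z=1$ the opposite field of [a] is $Y(e^{L_1}(-1)^{L_0}a,1)$; the weights single out one
    mode. *)
Lemma pairing_opposite f d g b a c : wt V f b -> wt V d a -> wt V g c ->
  pairing b (e (s a)) c = h b (opposite_mode a (d + f - g - 1) c).
Proof.
move=> wb wa wc; have [N aN] := L1_nilpotent a.
rewrite (sgnL0_homogeneous wa) expL1Z (expL1E _ aN) pairingZm pairing_summ.
rewrite (opposite_mode_homogeneous _ _ wa aN) (hsumr hs) mulr_sumr.
apply: eq_bigr => l _.
rewrite pairingZm (pairing_homogeneous wb (wt_iter_L 1 l wa) wc) (hZr hs).
by rewrite expr1n mulrA mul1r; congr (_ * h _ (Y _ _ _)); lia.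
Qed.

Variable theta : V -> V.
Hypotheses
  (thetaP : forall a n b c, h (Y (theta a) n b) c = h b (opposite_mode a n c))
  (theta_antilinear :
     forall x a b, theta (x *: a + b) = x^* *: theta a + theta b)
  (theta_vacuum : theta Om = Om)
  (wt_theta : forall d a, wt V d a -> wt V d (theta a))
  (theta_L1 : forall a, theta (L 1 a) = L 1 (theta a)).

Let thetaD a b : theta (a + b) = theta a + theta b.
Proof. by rewrite -[a]scale1r theta_antilinear conjC1 !scale1r. Qed.
Let theta0 : theta 0 = 0.
Proof. by apply: (@addrI _ (theta 0)); rewrite -thetaD !addr0. Qed.
Let thetaZ x a : theta (x *: a) = x^* *: theta a.
Proof. by rewrite -[x *: a]addr0 theta_antilinear theta0 addr0. Qed.
Let theta_sum (I : Type) (r : seq I) (P : pred I) (F : I -> V) :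
  theta (\sum_(i <- r | P i) F i) = \sum_(i <- r | P i) theta (F i).
Proof. by apply: (big_morph theta) => [u v|]; rewrite ?thetaD ?theta0. Qed.

Lemma theta_iter_L1 l a : theta (iter l (L 1) a) = iter l (L 1) (theta a).
Proof. by elim: l => //= l <-; rewrite theta_L1. Qed.

Lemma conj_sign (n : int) : ((-1) ^ n : K)^* = (-1) ^ n.
Proof. by rewrite fmorphXz rmorphN1. Qed.

Lemma conj_sign_fact (n : int) (l : nat) :
  ((-1) ^ n / l`!%:R : K)^* = (-1) ^ n / l`!%:R.
Proof. by rewrite rmorphM fmorphV /= conj_sign rmorph_nat. Qed.

Lemma iter_transl_adjoint l a b : h (iter l T a) b = h a (iter l (L 1) b).
Proof.
by elim: l b => //= l IH b; rewrite (transl_adjoint moebius) IH -iterSr.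
Qed.

Lemma iter_L1_adjoint l a b : h (iter l (L 1) a) b = h a (iter l T b).
Proof.
by elim: l b => //= l IH b; rewrite (L1_adjoint moebius) IH -iterSr.
Qed.

(* The three-point function (theta b | Y(a, 1) c). Skew-symmetry of Y gives its
   behaviour under a <-> c, skew-symmetry for theta a and theta b that under
   a <-> b; together they generate all permutations. *)
Let t a b c := pairing (theta b) a c.

Let tDa a a' b c : t (a + a') b c = t a b c + t a' b c.
Proof. exact: pairingDm. Qed.
Let tDb a b b' c : t a (b + b') c = t a b c + t a b' c.
Proof. by rewrite /t thetaD pairingDl. Qed.
Let tDc a b c c' : t a b (c + c') = t a b c + t a b c'.
Proof. exact: pairingDr. Qed.
Let tZb x a b c : t a (x *: b) c = x * t a b c.
Proof. by rewrite /t thetaZ pairingZl conjCK. Qed.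

(** In $Y(a,1)c = e^T Y(c,-1)a$ the factor $e^T$ passes to the left as $e^{L_1}$, and $(-1)^{L_0}$
    turns the argument $-1$ into 1. *)
Lemma three_point_swap_ac a b c : t a b c = t (s c) (s (e b)) (s a).
Proof.
elim/homogeneous_ind: a => [d a wa|a a' E E']; last first.
  by rewrite sgnL0D tDa tDc E E'.
elim/homogeneous_ind: c => [g c wc|c c' E E']; last first.
  by rewrite sgnL0D tDc tDa E E'.
elim/homogeneous_ind: b => [f b wb|b b' E E']; last first.
  by rewrite expL1D sgnL0D !tDb E E'.
rewrite [LHS](pairing_homogeneous (wt_theta wb) wa wc).
have [M skew] := skew_symmetry a c; have [N bN] := L1_nilpotent b.
(* Long enough for both the skew-symmetry sum and the exponential on [b]. *)
set k := d + g - f - 1; pose J := (absz (M - k)%R + N)%N.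
have bJ l : (J <= l)%N -> iter l (L 1) b = 0 by move=> ?; apply: bN; lia.
rewrite (skew k J); last by lia.
rewrite (hsumr hs) (expL1E _ bJ) sgnL0_sum.
rewrite (sgnL0_homogeneous wa) (sgnL0_homogeneous wc) /t pairingZm pairingZr.
rewrite theta_sum pairing_suml !mulr_sumr; apply: eq_bigr => j _.
rewrite sgnL0Z (sgnL0_homogeneous (wt_iter_L 1 j wb)) -/(t _ _ _) !tZb /t.
rewrite (pairing_homogeneous (wt_theta (wt_iter_L 1 j wb)) wc wa) (hZr hs).
rewrite theta_iter_L1 iter_L1_adjoint expr1n !mulrA.
congr (_ * h _ (iter _ _ (Y _ _ _))); last by lia.
rewrite !mulr1 [RHS]mulrAC -!exprzDr ?unitrN1 // /k.
by congr (_ / _); apply: (@signz_parity _ _ _ (j%:Z - f)); lia.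
Qed.

(** The left side is $(Y(\theta a,1)\theta b|c)$; skew-symmetry moves $e^{L_1}$ onto [c]. *)
Lemma three_point_swap_ab a b c : t (e (s a)) b c = t (e b) (s a) (s (e c)).
Proof.
elim/homogeneous_ind: a => [d a wa|a a' E E']; last first.
  by rewrite sgnL0D expL1D tDa tDb E E'.
elim/homogeneous_ind: b => [f b wb|b b' E E']; last first.
  by rewrite expL1D tDa tDb E E'.
elim/homogeneous_ind: c => [g c wc|c c' E E']; last first.
  by rewrite expL1D sgnL0D !tDc E E'.
rewrite [LHS](pairing_opposite (wt_theta wb) wa wc) -thetaP.
have [M skew] := skew_symmetry (theta a) (theta b).
have [N cN] := L1_nilpotent c.
set k := d + f - g - 1; pose J := (absz (M - k)%R + N)%N.
have cJ l : (J <= l)%N -> iter l (L 1) c = 0 by move=> ?; apply: cN; lia.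
rewrite (skew k J); last by lia.
rewrite (hsuml hs) (expL1E _ cJ) sgnL0_sum.
rewrite (sgnL0_homogeneous wa) tZb /t pairing_sumr mulr_sumr.
apply: eq_bigr => j _.
have wj := wt_iter_L 1 j wc.
rewrite sgnL0Z (sgnL0_homogeneous wj) !pairingZr (hZl hs) conj_sign_fact.
rewrite iter_transl_adjoint thetaP.
have -> : e b = (-1) ^ f *: e (s b).
  rewrite (sgnL0_homogeneous wb) expL1Z scalerA -exprzDr ?unitrN1 //.
  by rewrite (@signz_parity _ _ 0 f) ?expr0z ?scale1r //; lia.
rewrite pairingZm (pairing_opposite (wt_theta wa) wb wj) expr1n !mulrA.
congr (_ * h _ (opposite_mode _ _ _)); last by lia.
rewrite !mulr1 -[RHS]mulrA [RHS]mulrAC -!exprzDr ?unitrN1 // /k.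
by congr (_ / _); apply: (@signz_parity _ _ _ (j%:Z - g)); lia.
Qed.

(** Both sides equal $t(e^{L_1}b,\ e^{-L_1}a,\ (-1)^{L_0}e^{L_1}c)$. *)
Lemma three_point_swap_bc a b c : t (e (s a)) c b = t a b c.
Proof.
rewrite three_point_swap_ab three_point_swap_ac sgnL0K sgnL0_expL1.
rewrite -[a in RHS](expL1K a) -[e' a in RHS]sgnL0K three_point_swap_ab.
by rewrite sgnL0K.
Qed.

(** Evaluation at $z=1$ loses nothing: for homogeneous vectors all modes but one vanish on both
    sides, and the remaining one is the three-point function. *)
Lemma theta_reflection a b c n :
  h (theta b) (Y a n c) = h (theta c) (opposite_mode a n b).
Proof.
elim/homogeneous_ind: a => [d a wa|a a' E E']; last first.
  rewrite YDl (hDr hs) E E' -(hDr hs).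
  by rewrite -{2}[a]scale1r opposite_mode_linear scale1r.
elim/homogeneous_ind: b => [f b wb|b b' E E']; last first.
  rewrite thetaD (hDl hs) E E' -(hDr hs).
  by rewrite -{2}[b]scale1r opposite_mode_linearr scale1r.
elim/homogeneous_ind: c => [g c wc|c c' E E']; last first.
  by rewrite thetaD (hDl hs) -E -E' YD (hDr hs).
have [->|ne] := eqVneq n (d + g - f - 1).
  rewrite -(pairing_homogeneous (wt_theta wb) wa wc).
  rewrite -(pairing_opposite (wt_theta wc) wa wb).
  exact: esym (three_point_swap_bc a b c).
rewrite (wt_orthogonal hs moebius (wt_theta wb) (wt_Y n wa wc)).
  rewrite (wt_orthogonal hs moebius (wt_theta wc)
    (wt_opposite_mode n wa wb)) //.
  by apply: contraNneq ne => ?; apply/eqP; lia.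
by apply: contraNneq ne => ?; apply/eqP; lia.
Qed.

Lemma theta_symmetric a b : h (theta a) b = h (theta b) a.
Proof.
have := theta_reflection b a Om (-1); rewrite Y_creation1 theta_vacuum => ->.
by rewrite -thetaP Y_creation1.
Qed.

Lemma theta_product a b n : theta (Y a n b) = Y (theta a) n (theta b).
Proof.
apply: (h_injl hs) => c.
by rewrite theta_symmetric theta_reflection thetaP.
Qed.

Lemma theta_expL1 a : theta (e a) = e (theta a).
Proof.
have [N aN] := L1_nilpotent a.
have taN l : (N <= l)%N -> iter l (L 1) (theta a) = 0.
  by move=> le; rewrite -theta_iter_L1 aN ?theta0.
rewrite (expL1E _ aN) (expL1E _ taN) theta_sum; apply: eq_bigr => l _.
rewrite thetaZ theta_iter_L1 expr1n; congr (_ *: _).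
by rewrite rmorphM fmorphV /= conjC1 rmorph_nat.
Qed.

Lemma theta_sgnL0 a : theta (s a) = s (theta a).
Proof.
elim/homogeneous_ind: a => [d a wa|a b E E'].
  by rewrite (sgnL0_homogeneous wa) thetaZ (sgnL0_homogeneous (wt_theta wa))
    conj_sign.
by rewrite sgnL0D !thetaD sgnL0D E E'.
Qed.

Lemma pairing_theta a b c :
  pairing b (e (s a)) c = (pairing c (theta a) b)^*.
Proof.
elim/homogeneous_ind: a => [d a wa|a a' E E']; last first.
  by rewrite sgnL0D expL1D thetaD !pairingDm rmorphD E E'.
elim/homogeneous_ind: b => [f b wb|b b' E E']; last first.
  by rewrite pairingDl pairingDr rmorphD E E'.
elim/homogeneous_ind: c => [g c wc|c c' E E']; last first.
  by rewrite pairingDl pairingDr rmorphD E E'.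
rewrite (pairing_opposite wb wa wc).
by rewrite (pairing_homogeneous wc (wt_theta wa) wb) -(h_sym hs) thetaP.
Qed.

(** Take adjoints twice at $z=1$: $e^{L_1}(-1)^{L_0}$ is an involution commuting with $\theta$, and
    $c = \Omega$ recovers the vector. *)
Lemma theta_involutive a : theta (theta a) = a.
Proof.
elim/homogeneous_ind: a => [d a wa|a b E E']; last by rewrite !thetaD E E'.
have P b c : pairing b (theta (theta a)) c = pairing b a c.
  rewrite -[a in RHS]expL1_sgnL0K pairing_theta theta_expL1 theta_sgnL0.
  by rewrite pairing_theta conjCK.
apply: (h_injl_homogeneous hs) => f b wb.
rewrite (h_sym hs b) (h_sym hs b a); congr (_^*).
have [ed|ne] := eqVneq f d.
  have := P b Om.
  rewrite (pairing_homogeneous wb wa (@wt_vacuum _ V)).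
  rewrite (pairing_homogeneous wb (wt_theta (wt_theta wa)) (@wt_vacuum _ V)).
  have -> : d + 0 - f - 1 = -1 by lia.
  by rewrite !Y_creation1.
rewrite (wt_orthogonal hs moebius wb (wt_theta (wt_theta wa)) ne).
by rewrite (wt_orthogonal hs moebius wb wa ne).
Qed.

Lemma theta_conformal :
  (forall v, wt V 0 v -> exists x, v = x *: Om) -> theta nu = nu.
Proof.
move=> V0; pose u := theta nu - nu.
have wu : wt V 2 u.
  rewrite /u -scaleN1r.
  exact: (wtD (wt_theta (@wt_conformal _ V)) (wtZ (-1) (@wt_conformal _ V))).
have L1u : L 1 u = 0 by rewrite LB -theta_L1 L1_conformal theta0 subrr.
have [x L2u] : exists x, L 2 u = x *: Om by apply: V0; exact: (wt_L 2 wu).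
(* Brackets with $L_1$ climb from $L_2u$, a multiple of $\Omega$, to all higher modes. *)
have Lu (n : nat) : L n.+3%:Z u = 0.
  elim: n => [|n IH].
    have := @virasoro _ V 1 2 u isT.
    by rewrite L2u LZ L_vacuum // scaler0 L1u L_0 add0r => /esym/eqP;
      rewrite oppr_eq0 => /eqP.
  have := @virasoro _ V 1 n.+3%:Z u isT.
  rewrite IH L1u !L_0 add0r => /esym/eqP.
  rewrite -scaler_int scaler_eq0 intr_eq0 => /orP[/eqP|/eqP]; first lia.
  by congr (L _ _ = _); lia.
(* $(\theta\nu)_{(1)}$ is the adjoint of $L_0$, which is self-adjoint. *)
have u1 v : Y u 1 v = 0.
  apply: (h_nondegenerate hs) => c; rewrite /u YBl (hBl hs) thetaP.
  by rewrite opposite_mode_conformal -(L0_adjoint moebius) LE subrr.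
have [M skew] := skew_symmetry u nu.
(* The $j$-th term is a multiple of $T^jL_ju$: only $j=0$ survives, with $L_0u = 2u$; the term $j=2$
   drops out because $T\Omega = 0$. *)
have := skew 1 (absz M).+1; rewrite u1 => /(_ _)/esym.
move=> /(_ ltac:(lia)); rewrite big_ord_recl big1 => [|[j /= _] _]; last first.
  rewrite /bump /= add1n.
  case: j => [|[|j]] /=.
  - by rewrite -[Y nu _ u]/(L 1 u) L1u transl0 scaler0.
  - by rewrite -[Y nu _ u]/(L 2 u) L2u !translZ transl_vacuum transl0 !scaler0.
  rewrite [1 + _]addrC -[Y nu _ u]/(L j.+3 u) Lu.
  by rewrite iter_transl0 !transl0 scaler0.
rewrite addr0 /= addr0 fact0 divr1 (wu : Y nu 1 u = _).
rewrite -exprnP sqrrN expr1n scale1r -scaler_int => /eqP.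
by rewrite scaler_eq0 intr_eq0 /= subr_eq0 => /eqP.
Qed.

Lemma theta_invariant :
  (forall v, wt V 0 v -> exists x, v = x *: Om) -> invariant_scalar_product h.
Proof.
move=> V0; split=> //; exists theta; split.
  split=> //.
  - by exists theta; exact: theta_involutive.
  - by move=> a b n; exact: theta_product.
  - exact: theta_conformal.
split; first split.
- by move=> x a b c; rewrite theta_antilinear (hDl hs) (hZl hs) conjCK.
- by move=> x a b c; rewrite (hDr hs) (hZr hs).
by move=> a b c n; rewrite theta_product thetaP.
Qed.

End Reflection.

Theorem theorem5p16 (R : realType) (V : VOA R) (h : V -> V -> R[i])
    (h_scalar : scalar_product h) (h_normalized : normalized h)
    (V0 : wt V 0 = [set c *: vacuum V | c in [set: R[i]]]) :
  unitary_VOA h <->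
  (unitary_moebius_symmetry h /\ local_adjoint_set h = [set: V]).
Proof.
split=> [[_ inv]|[moebius loc]]; first exact: invariant_moebius_local.
split=> //.
have local_adjoints a : has_local_adjoint h a.
  by have : [set: V] a by []; rewrite -loc.
apply: (theta_invariant h_scalar moebius
  (theta := theta h_scalar moebius local_adjoints)).
- exact: thetaP.
- exact: theta_antilinear.
- exact: theta_vacuum.
- exact: wt_theta.
- exact: theta_L1.
by move=> v; rewrite V0 => -[x _ <-]; exists x.
Qed.
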